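(* Let $(m,n)\in\mathbb N^2_+$ and let $h\in\mathcal M_{m,n}$. Then $\Xi_{m,n}(\tau_{m,n}(h))=0$; that is, $$\tau_{m,n}(h)\in D_{m,n}(A,B)\simeq\mathrm{Der}^\omega_{m,n}(\mathfrak{Lie}(A,B)).$$ In other words, the $(m,n)$-double Johnson homomorphism $\tau_{m,n}(h)$ is a symplectic derivation of $\mathfrak{Lie}(A,B)$.
   Context: Let $g\ge0$ be an integer. Let $S^3=V\cup V'$ be the standard Heegaard splitting of genus $g$ ($V,V'$ handlebodies of genus $g$ with $\partial V=\partial V'$). Fix a disk $D\subset\partial V$, and let $\Sigma$ be the compact connected oriented surface of genus $g$ with one boundary component such that $\partial V=\Sigma\cup D$; fix $*\in\partial\Sigma$. $K=\pi_1(\Sigma,* )$ is free with free basis $\{x_i,y_i\}_{1\le i\le g}$ given by the standard meridians $x_i$ (bounding disks in $V$) and parallels $y_i$ (bounding disks in $V'$), chosen so that the inverse of the class of the boundary loop is $\prod_{i=1}^g[x_i^{-1},y_i^{-1}]$. Let $\bar X=\ker(K\to\pi_1(V,* ))=\langle\langle x_1,\dots,x_g\rangle\rangle_K$ and $\bar Y=\ker(K\to\pi_1(V',* ))=\langle\langle y_1,\dots,y_g\rangle\rangle_K$. $\mathcal M$ is the group of isotopy classes of orientation-preserving homeomorphisms of $\Sigma$ fixing $\partial\Sigma$ pointwise; it acts on $K$. Write $[a,b]=aba^{-1}b^{-1}$, $[h,k]=h(k)k^{-1}$ for $h\in\mathcal M$, $k\in K$. $\mathbb N^2_+=\mathbb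 N^2\setminus\{(0,0)\}$. Double lower central series of $(K;\bar X,\bar Y)$: $K_{0,0}=K$, $K_{m,0}=\Gamma_m\bar X$ and $K_{0,n}=\Gamma_n\bar Y$ for $m,n\ge1$ ($\Gamma_\bullet$ = lower central series), $K_{m,n}=[K_{1,0},K_{m-1,n}][K_{0,1},K_{m,n-1}]$ for $m,n\ge1$. $K_{>(m,n)}=K_{m+1,n}K_{m,n+1}$ and $\bar K_{m,n}=K_{m,n}/K_{>(m,n)}$. For $(m,n)\in\mathbb N^2$, $$\mathcal M_{m,n}=\{h\in\mathcal M\mid h(\bar X)=\bar X,\ h(\bar Y)=\bar Y,\ [h,\bar X]\subset K_{m+1,n},\ [h,\bar Y]\subset K_{m,n+1}\}.$$ $H=H_1(\Sigma;\mathbb Z)$, $A=\ker(H\to H_1(V;\mathbb Z))$, $B=\ker(H\to H_1(V';\mathbb Z))$, so $H=A\oplus B$; $a_i\in A$, $b_i\in B$ are the classes of $x_i,y_i$, forming a symplectic basis of $H$ for the intersection form $\omega$ ($\omega(a_i,b_j)=\delta_{ij}$). $\mathfrak{Lie}(A,B)=\bigoplus_{(m,n)\in\mathbb N^2_+}\mathfrak{Lie}_{m,n}(A,B)$ is the Lie algebra over $\mathbb Z$ freely generated by $A$ in degree $(1,0)$ and $B$ in degree $(0,1)$; it is identified with $\bar K=\bigoplus\bar K_{m,n}$ (bracket induced by commutators) via $a_i\mapsto x_iK_{>(1,0)}$, $b_i\mapsto y_iK_{>(0,1)}$. $\mathrm{Der}_{m,n}(\mathfrak{Lie}(A,B))$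 is the group of derivations of degree $(m,n)$. It is identified with $(A\otimes\mathfrak{Lie}_{m,n+1}(A,B))\oplus(B\otimes\mathfrak{Lie}_{m+1,n}(A,B))$ via restriction to $A$ and $B$ and the isomorphisms $A\simeq B^*$, $B\simeq A^*$, $z\mapsto\omega(z,\cdot)$; explicitly, $d\mapsto\sum_ia_i\otimes d(b_i)-\sum_ib_i\otimes d(a_i)$. For $h\in\mathcal M_{m,n}$, $(m,n)\in\mathbb N^2_+$, $\tau_{m,n}(h)$ is the derivation of degree $(m,n)$ with $zK_{>(i,j)}\mapsto[h,z]K_{>(m+i,n+j)}$ for $z\in K_{i,j}$, i.e. under the identification $$\tau_{m,n}(h)=\sum_{i=1}^ga_i\otimes([h,y_i]K_{>(m,n+1)})-\sum_{i=1}^gb_i\otimes([h,x_i]K_{>(m+1,n)}).$$ $\Xi_{m,n}\colon(A\otimes\mathfrak{Lie}_{m,n+1}(A,B))\oplus(B\otimes\mathfrak{Lie}_{m+1,n}(A,B))\to\mathfrak{Lie}_{m+1,n+1}(A,B)$ is the Lie bracket map, and $D_{m,n}(A,B)=\ker\Xi_{m,n}$. A derivation $d$ of $\mathfrak{Lie}(A,B)$ is symplectic if $d(\Omega)=0$, where $\Omega=\sum_{i=1}^g[a_i,b_i]$; $\mathrm{Der}^\omega_{m,n}(\mathfrak{Lie}(A,B))$ is the group of symplectic derivations of degree $(m,n)$, which corresponds to $D_{m,n}(A,B)$ under the identification above. *)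

(* Defs.v *)
From HB Require Import structures.
From mathcomp Require Import all_boot all_order all_algebra generic_quotient.
From mathcomp Require Import all_classical all_reals topology normedtype.
From mathcomp Require Import ring lra.
Set Implicit Arguments.
Unset Strict Implicit.
Unset Printing Implicit Defensive.
Import Order.TTheory GRing.Theory Num.Theory.
Import numFieldNormedType.Exports.
Local Open Scope classical_set_scope.
Local Open Scope ring_scope.
Local Open Scope quotient_scope.

Section Pasting.

Lemma within_comp (S T U : topologicalType) (A : set S) (B : set T)
    (f : S -> T) (g : T -> U) :
  continuous f -> (forall x, A x -> B (f x)) ->
  {within B, continuous g} -> {within A, continuous (g \o f)}.
Proof.
move=> cf AB /subspace_continuousP cg; apply/subspace_continuousP => x Ax.
move=> W /(cg _ (AB _ Ax)) gW.
have fW : nbhs x (f @^-1` (fun y => B y -> W (g y))) by exact: (cf x).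
by rewrite /= nbhs_simpl /within /=; apply: filterS fW => y Hy Ay; exact/Hy/AB.
Qed.

Lemma within_eq (S U : topologicalType) (A : set S) (f g : S -> U) :
  (forall x, A x -> f x = g x) ->
  {within A, continuous f} -> {within A, continuous g}.
Proof.
by move=> fg; apply: subspace_eq_continuous => x /set_mem; exact: fg.
Qed.

Lemma within_paste (R : realType) (S U : topologicalType) (A : set S)
    (phi : S -> R) (c : R) (f g : S -> U) :
  closed A -> continuous phi ->
  {within [set x | A x /\ phi x <= c], continuous f} ->
  {within [set x | A x /\ c <= phi x], continuous g} ->
  (forall x, A x -> phi x = c -> f x = g x) ->
  {within A, continuous (fun x => if phi x <= c then f x else g x)}.
Proof.
move=> cA cphi cf cg fg.
have -> : A = [set x | A x /\ phi x <= c] `|` [set x | A x /\ c <= phi x].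
  rewrite eqEsubset; split => [x Ax|x [[]|[]]//].
  by have [|/ltW] := leP (phi x) c; [left|right].
apply: withinU_continuous.
- apply: (@closedI _ A (phi @^-1` [set y | y <= c])) => //.
  by apply: preimage_closed; [move=> ? _; exact: cphi|exact: closed_le].
- apply: (@closedI _ A (phi @^-1` [set y | c <= y])) => //.
  by apply: preimage_closed; [move=> ? _; exact: cphi|exact: closed_ge].
- by apply: within_eq cf => x [_ ->].
- apply: within_eq cg => x [Ax cx]; case: ifPn => // xc.
  by rewrite fg //; apply: le_anti; rewrite xc.
Qed.

End Pasting.

Section Affine.
Context (R : realType) (S : topologicalType).
Implicit Types f g : S -> R.

Lemma cts_affine f (a b : R) :
  continuous f -> continuous (fun z => a * f z + b).
Proof.
move=> cf z; apply: (@cvgD _ R^o); last exact: cvg_cst.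
by apply: cvgM; [exact: cvg_cst|exact: cf].
Qed.

Lemma cts_min f g :
  continuous f -> continuous g -> continuous (fun z => Num.min (f z) (g z)).
Proof. by move=> cf cg z; apply: continuous_min; [exact: cf|exact: cg]. Qed.

Lemma cts_max f g :
  continuous f -> continuous g -> continuous (fun z => Num.max (f z) (g z)).
Proof. by move=> cf cg z; apply: continuous_max; [exact: cf|exact: cg]. Qed.

Lemma cts_pair (T U : topologicalType) (f : S -> T) (g : S -> U) :
  continuous f -> continuous g -> continuous (fun z => (f z, g z)).
Proof. by move=> cf cg z; apply: cvg_pair; [exact: cf|exact: cg]. Qed.

Lemma cts_mix (s f g : S -> R) : continuous s -> continuous f ->
  continuous g -> continuous (fun z => (1 - s z) * f z + s z * g z).
Proof.
move=> cs cf cg z; apply: (@cvgD _ R^o).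
  apply: cvgM; last exact: cf.
  by apply: (@cvgB _ R^o); [exact: cvg_cst|exact: cs].
by apply: cvgM; [exact: cs|exact: cg].
Qed.

End Affine.

Local Ltac split_minmax := repeat match goal with
  | |- context [Order.min ?a ?b] =>
      lazymatch a with
      | context [Order.min _ _] => fail
      | _ => case: (leP a b) => ?
      end
  | |- context [Order.max ?a ?b] => case: (leP a b) => ?
  end.

Section FundamentalGroup.
Context (R : realType) (X : topologicalType) (p : X).

Local Notation I := (`[0, 1]%classic : set R).

(** A loop is a function on [R] of which only the restriction to the unit
    interval matters. *)
Record loop := Loop {
  loop_fun :> R -> X;
  loop_cont : {within I, continuous loop_fun};
  loop0 : loop_fun 0 = p;
  loop1 : loop_fun 1 = p }.

HB.instance Definition _ := gen_eqMixin loop.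
HB.instance Definition _ := gen_choiceMixin loop.

Definition homotopic (u v : loop) : Prop :=
  exists F : R * R -> X,
    [/\ {within I `*` I, continuous F},
        forall t, I t -> F (0, t) = u t,
        forall t, I t -> F (1, t) = v t,
        forall s, I s -> F (s, 0) = p &
        forall s, I s -> F (s, 1) = p].

Let IE (t : R) : I t <-> 0 <= t <= 1.
Proof. by rewrite /= in_itv. Qed.

Let I0 : I 0. Proof. by apply/IE; rewrite lexx ler01. Qed.
Let I1 : I 1. Proof. by apply/IE; rewrite lexx ler01. Qed.

Let closedII : closed (I `*` I).
Proof.
have -> : I `*` I = (fst @^-1` I) `&` (snd @^-1` I) by [].
by apply: closedI; apply: preimage_closed; try exact: itv_closed;
  move=> ? _; [exact: cvg_fst|exact: cvg_snd].
Qed.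

Let cts_id : continuous (fun t : R => t).
Proof. by move=> t; exact: cvg_id. Qed.

Let cts_fst : continuous (fun z : R * R => z.1).
Proof. by move=> z; exact: cvg_fst. Qed.

Let cts_snd : continuous (fun z : R * R => z.2).
Proof. by move=> z; exact: cvg_snd. Qed.

Lemma homotopic_reparam (u v w : loop) (phi psi : R -> R) :
  continuous phi -> continuous psi ->
  (forall t, I t -> I (phi t)) -> (forall t, I t -> I (psi t)) ->
  phi 0 = psi 0 -> phi 1 = psi 1 ->
  (forall t, I t -> v t = u (phi t)) -> (forall t, I t -> w t = u (psi t)) ->
  homotopic v w.
Proof.
move=> cphi cpsi Iphi Ipsi e0 e1 vE wE.
exists (u \o (fun z : R * R => (1 - z.1) * phi z.2 + z.1 * psi z.2)); split.
- apply: (@within_comp _ _ _ _ I); last exact: loop_cont.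
    apply: cts_mix => // z.
      by apply: continuous_comp; [exact: cvg_snd|exact: cphi].
    by apply: continuous_comp; [exact: cvg_snd|exact: cpsi].
  move=> [s t] /= [/IE/andP[s0 s1]] It.
  have /IE/andP[a0 a1] := Iphi _ It; have /IE/andP[b0 b1] := Ipsi _ It.
  by apply/IE/andP; split; nra.
- by move=> t It /=; rewrite vE// subr0 mul1r mul0r addr0.
- by move=> t It /=; rewrite wE// subrr mul1r mul0r add0r.
- move=> s Is /=; rewrite -e0 -mulrDl subrK mul1r -vE// loop0//.
- move=> s Is /=; rewrite -e1 -mulrDl subrK mul1r -vE// loop1//.
Qed.

Lemma homotopic_refl (u : loop) : homotopic u u.
Proof. by apply: (@homotopic_reparam u u u id id). Qed.

Lemma homotopic_sym (u v : loop) : homotopic u v -> homotopic v u.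
Proof.
case=> F [cF F0 F1 Fl Fr].
have II s : I s -> I (-1 * s + 1).
  by move=> /IE/andP[s0 s1]; apply/IE/andP; split; lra.
exists (F \o (fun z => (-1 * z.1 + 1, z.2))); split.
- apply: (@within_comp _ _ _ _ (I `*` I)) => //.
    by apply: cts_pair => //; apply: cts_affine.
  by move=> [s t] [/= Is It]; split => //=; exact: II.
- by move=> t It /=; rewrite mulr0 add0r; exact: F1.
- by move=> t It /=; rewrite mulr1 addNr; exact: F0.
- by move=> s /II; exact: Fl.
- by move=> s /II; exact: Fr.
Qed.

Let half1 (t : R) : I t -> t <= 2^-1 -> I (2 * t + 0).
Proof. by move=> /IE/andP[t0 t1] ht; apply/IE/andP; split; lra. Qed.

Let half2 (t : R) : I t -> 2^-1 <= t -> I (2 * t + -1).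
Proof. by move=> /IE/andP[t0 t1] ht; apply/IE/andP; split; lra. Qed.

Let half01 : ((0 : R) <= 2^-1) = true. Proof. by rewrite invr_ge0 ler0n. Qed.
Let half11 : ((1 : R) <= 2^-1) = false. Proof. by apply/negbTE; lra. Qed.
Let dbl0 : 2 * 0 + 0 = 0 :> R. Proof. by rewrite mulr0 addr0. Qed.
Let dbl1 : 2 * 1 + -1 = 1 :> R. Proof. by lra. Qed.
Let dblh0 : 2 * 2^-1 + 0 = 1 :> R. Proof. by lra. Qed.
Let dblh1 : 2 * 2^-1 + -1 = 0 :> R. Proof. by lra. Qed.

Lemma homotopic_trans (u v w : loop) :
  homotopic u v -> homotopic v w -> homotopic u w.
Proof.
case=> F [cF F0 F1 Fl Fr] [G [cG G0 G1 Gl Gr]].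
exists (fun z : R * R => if z.1 <= 2^-1 then F (2 * z.1 + 0, z.2)
                         else G (2 * z.1 + -1, z.2)); split.
- apply: within_paste => //.
  + apply: (@within_comp _ _ _ _ (I `*` I)
        (fun z : R * R => (2 * z.1 + 0, z.2)) F) => //.
      by apply: cts_pair => //; apply: cts_affine.
    by move=> [s t] [[/= Is It]] hs; split => //=; exact: half1.
  + apply: (@within_comp _ _ _ _ (I `*` I)
        (fun z : R * R => (2 * z.1 + -1, z.2)) G) => //.
      by apply: cts_pair => //; apply: cts_affine.
    by move=> [s t] [[/= Is It]] hs; split => //=; exact: half2.
  + by move=> [s t] [/= Is It] ->; rewrite dblh0 dblh1 F1// G0.
- by move=> t It /=; rewrite half01 dbl0 F0.
- by move=> t It /=; rewrite half11 dbl1 G1.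
- move=> s Is /=; case: ifPn => [hs|]; first by apply/Fl/half1.
  by rewrite -ltNge => /ltW hs; apply/Gl/half2.
- move=> s Is /=; case: ifPn => [hs|]; first by apply/Fr/half1.
  by rewrite -ltNge => /ltW hs; apply/Gr/half2.
Qed.

(** Concatenation: first [u], then [v]. *)
Definition cat_fun (u v : R -> X) (t : R) : X :=
  if t <= 2^-1 then u (2 * t + 0) else v (2 * t + -1).

Fact cat_loop_cont (u v : loop) : {within I, continuous (cat_fun u v)}.
Proof.
apply: (@within_paste R _ _ I (fun t : R => t) 2^-1
  (fun t => u (2 * t + 0)) (fun t => v (2 * t + -1))) => //.
- exact: itv_closed.
- refine (@within_comp R R X _ I (fun t => 2 * t + 0) u _ _ _).
  + exact: cts_affine.
  + by move=> t [It ht]; exact: half1.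
  + exact: loop_cont.
- refine (@within_comp R R X _ I (fun t => 2 * t + -1) v _ _ _).
  + exact: cts_affine.
  + by move=> t [It ht]; exact: half2.
  + exact: loop_cont.
- by move=> t _ ->; rewrite dblh0 dblh1 loop0 loop1.
Qed.

Fact cat_loop0 (u v : loop) : cat_fun u v 0 = p.
Proof. by rewrite /cat_fun half01 dbl0 loop0. Qed.

Fact cat_loop1 (u v : loop) : cat_fun u v 1 = p.
Proof. by rewrite /cat_fun half11 dbl1 loop1. Qed.

Definition cat_loop (u v : loop) : loop :=
  Loop (@cat_loop_cont u v) (cat_loop0 u v) (cat_loop1 u v).

Fact cst_loop_cont : {within I, continuous (fun _ : R => p)}.
Proof. by apply: continuous_subspaceT => t; exact: cvg_cst. Qed.

Definition cst_loop : loop := Loop cst_loop_cont erefl erefl.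

Fact rev_loop_cont (u : loop) : {within I, continuous (fun t => u (1 - t))}.
Proof.
refine (@within_comp R R X _ I (fun t : R => 1 - t) u _ _ _).
- by move=> t; apply: (@cvgB _ R^o); [exact: cvg_cst|exact: cvg_id].
- by move=> t /IE/andP[t0 t1]; apply/IE/andP; split; lra.
- exact: loop_cont.
Qed.

Fact rev_loop0 (u : loop) : u (1 - 0) = p.
Proof. by rewrite subr0 loop1. Qed.

Fact rev_loop1 (u : loop) : u (1 - 1) = p.
Proof. by rewrite subrr loop0. Qed.

Definition rev_loop (u : loop) : loop :=
  Loop (@rev_loop_cont u) (rev_loop0 u) (rev_loop1 u).

Lemma homotopic_cat (u u' v v' : loop) : homotopic u u' -> homotopic v v' ->
  homotopic (cat_loop u v) (cat_loop u' v').
Proof.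
case=> F [cF F0 F1 Fl Fr] [G [cG G0 G1 Gl Gr]].
exists (fun z : R * R => if z.2 <= 2^-1 then F (z.1, 2 * z.2 + 0)
                         else G (z.1, 2 * z.2 + -1)); split.
- apply: within_paste => //.
  + apply: (@within_comp _ _ _ _ (I `*` I)
        (fun z : R * R => (z.1, 2 * z.2 + 0)) F) => //.
      by apply: cts_pair => //; apply: cts_affine.
    by move=> [s t] [[/= Is It]] hs; split => //=; exact: half1.
  + apply: (@within_comp _ _ _ _ (I `*` I)
        (fun z : R * R => (z.1, 2 * z.2 + -1)) G) => //.
      by apply: cts_pair => //; apply: cts_affine.
    by move=> [s t] [[/= Is It]] hs; split => //=; exact: half2.
  + by move=> [s t] [/= Is It] ->; rewrite dblh0 dblh1 Fr// Gl.
- move=> t It /=; rewrite /cat_fun; case: ifPn => [ht|].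
    by apply/F0/half1.
  by rewrite -ltNge => /ltW ht; apply/G0/half2.
- move=> t It /=; rewrite /cat_fun; case: ifPn => [ht|].
    by apply/F1/half1.
  by rewrite -ltNge => /ltW ht; apply/G1/half2.
- by move=> s Is /=; rewrite half01 dbl0 Fl.
- by move=> s Is /=; rewrite half11 dbl1 Gr.
Qed.

Lemma homotopic_rev (u u' : loop) :
  homotopic u u' -> homotopic (rev_loop u) (rev_loop u').
Proof.
case=> F [cF F0 F1 Fl Fr].
have II s : I s -> I (1 - s).
  by move=> /IE/andP[s0 s1]; apply/IE/andP; split; lra.
exists (F \o (fun z => (z.1, 1 - z.2))); split.
- apply: (@within_comp _ _ _ _ (I `*` I)) => //.
    apply: cts_pair => // z.
    by apply: (@cvgB _ R^o); [exact: cvg_cst|exact: cvg_snd].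
  by move=> [s t] [/= Is It]; split => //=; exact: II.
- by move=> t /II; exact: F0.
- by move=> t /II; exact: F1.
- by move=> s Is /=; rewrite subr0 Fr.
- by move=> s Is /=; rewrite subrr Fl.
Qed.

Let cts_aff (a b : R) : continuous (fun t : R => a * t + b).
Proof. exact: cts_affine. Qed.

Lemma homotopic_catA (u v w : loop) :
  homotopic (cat_loop u (cat_loop v w)) (cat_loop (cat_loop u v) w).
Proof.
apply: homotopic_sym.
pose phi (t : R) := Num.min (Num.min (2 * t + 0) (1 * t + 4^-1))
                            (2^-1 * t + 2^-1).
apply: (@homotopic_reparam (cat_loop u (cat_loop v w)) _ _ phi id) => //.
- by apply: cts_min => //; apply: cts_min.
- move=> t /IE/andP[t0 t1]; apply/IE; rewrite /phi; split_minmax; apply/andP; split; lra.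
- by rewrite /phi; split_minmax; lra.
- by rewrite /phi; split_minmax; lra.
- move=> t /IE/andP[t0 t1]; rewrite /= /cat_fun.
  have [t2|t2] := leP t (2^-1).
    have -> : (2 * t + 0 <= 2^-1) = (t <= 4^-1) by apply/idP/idP => ?; lra.
    have [t4|t4] := leP t (4^-1).
      have -> : phi t = 2 * t + 0.
        rewrite /phi; split_minmax; lra.
      have -> : 2 * t + 0 <= 2^-1 by lra.
      by [].
    have -> : phi t = t + 4^-1.
      rewrite /phi; split_minmax; lra.
    have -> : (t + 4^-1 <= 2^-1) = false by apply/negbTE; lra.
    have -> : 2 * (t + 4^-1) + -1 <= 2^-1 by lra.
    by congr (v _); lra.
  have -> : phi t = 2^-1 * t + 2^-1.
    rewrite /phi; split_minmax; lra.
  have -> : (2^-1 * t + 2^-1 <= 2^-1) = false by apply/negbTE; lra.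
  have -> : (2 * (2^-1 * t + 2^-1) + -1 <= 2^-1) = false by apply/negbTE; lra.
  by congr (w _); lra.
Qed.

Lemma homotopic_cst_cat (u : loop) : homotopic (cat_loop cst_loop u) u.
Proof.
pose phi (t : R) := Num.max (0 * t + 0) (2 * t + -1).
apply: (@homotopic_reparam u _ _ phi id) => //.
- exact: cts_max.
- move=> t /IE/andP[t0 t1]; apply/IE; rewrite /phi; split_minmax; apply/andP; split; lra.
- by rewrite /phi; split_minmax; lra.
- by rewrite /phi; split_minmax; lra.
- move=> t /IE/andP[t0 t1]; rewrite /= /cat_fun.
  have [t2|t2] := leP t (2^-1); last first.
    by congr (u _); rewrite /phi; split_minmax; lra.
  rewrite -(loop0 u); congr (u _); rewrite /phi; split_minmax; lra.
Qed.

Lemma homotopic_cat_cst (u : loop) : homotopic (cat_loop u cst_loop) u.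
Proof.
pose phi (t : R) := Num.min (2 * t + 0) (0 * t + 1).
apply: (@homotopic_reparam u _ _ phi id) => //.
- exact: cts_min.
- move=> t /IE/andP[t0 t1]; apply/IE; rewrite /phi; split_minmax; apply/andP; split; lra.
- by rewrite /phi; split_minmax; lra.
- by rewrite /phi; split_minmax; lra.
- move=> t /IE/andP[t0 t1]; rewrite /= /cat_fun.
  have [t2|t2] := leP t (2^-1).
    by congr (u _); rewrite /phi; split_minmax; lra.
  rewrite -(loop1 u); congr (u _); rewrite /phi; split_minmax; lra.
Qed.

Lemma homotopic_rev_cat (u : loop) :
  homotopic (cat_loop (rev_loop u) u) cst_loop.
Proof.
pose phi (t : R) := Num.max (-2 * t + 1) (2 * t + -1).
apply: (@homotopic_reparam u _ _ phi (fun t => 0 * t + 1)) => //.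
- exact: cts_max.
- move=> t /IE/andP[t0 t1]; apply/IE; rewrite /phi; split_minmax; apply/andP; split; lra.
- by move=> t _; apply/IE/andP; split; lra.
- by rewrite /phi; split_minmax; lra.
- by rewrite /phi; split_minmax; lra.
- move=> t /IE/andP[t0 t1]; rewrite /= /cat_fun.
  have [t2|t2] := leP t (2^-1).
    by congr (u _); rewrite /phi; split_minmax; lra.
  by congr (u _); rewrite /phi; split_minmax; lra.
- by move=> t _; rewrite /= mul0r add0r loop1.
Qed.

Lemma homotopic_cat_rev (u : loop) :
  homotopic (cat_loop u (rev_loop u)) cst_loop.
Proof.
pose phi (t : R) := Num.min (2 * t + 0) (-2 * t + 2).
apply: (@homotopic_reparam u _ _ phi (fun t => 0 * t + 0)) => //.
- exact: cts_min.
- move=> t /IE/andP[t0 t1]; apply/IE; rewrite /phi; split_minmax; apply/andP; split; lra.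
- by move=> t _; apply/IE/andP; split; lra.
- by rewrite /phi; split_minmax; lra.
- by rewrite /phi; split_minmax; lra.
- move=> t /IE/andP[t0 t1]; rewrite /= /cat_fun.
  have [t2|t2] := leP t (2^-1).
    by congr (u _); rewrite /phi; split_minmax; lra.
  by congr (u _); rewrite /phi; split_minmax; lra.
- by move=> t _; rewrite /= mul0r add0r loop0.
Qed.

Fact homotopicb_equiv : equiv_class_of (fun u v => `[< homotopic u v >]).
Proof.
split.
- by move=> u; apply/asboolP; exact: homotopic_refl.
- by move=> u v; apply/asboolP/asboolP; exact: homotopic_sym.
- move=> v u w /asboolP uv /asboolP vw.
  by apply/asboolP; exact: homotopic_trans vw.
Qed.

Canonical homotopicb := EquivRelPack homotopicb_equiv.

Definition pi1 : Type := {eq_quot homotopicb}.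

HB.instance Definition _ := Choice.on pi1.
HB.instance Definition _ := EqQuotient.on pi1.

Definition pi1_class (u : loop) : pi1 := \pi_(pi1) u.

Lemma pi1_classP (u v : loop) : pi1_class u = pi1_class v <-> homotopic u v.
Proof.
split=> [/eqquotP/asboolP //|uv].
by apply/eqquotP/asboolP.
Qed.

Lemma pi1_repr (c : pi1) : pi1_class (repr c) = c.
Proof. by rewrite /pi1_class reprK. Qed.

Definition pi1_one : pi1 := pi1_class cst_loop.
Definition pi1_mul (c d : pi1) : pi1 := pi1_class (cat_loop (repr c) (repr d)).
Definition pi1_inv (c : pi1) : pi1 := pi1_class (rev_loop (repr c)).

Lemma pi1_mulE (u v : loop) :
  pi1_mul (pi1_class u) (pi1_class v) = pi1_class (cat_loop u v).
Proof. by apply/pi1_classP/homotopic_cat; apply/pi1_classP; rewrite pi1_repr. Qed.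

Lemma pi1_invE (u : loop) : pi1_inv (pi1_class u) = pi1_class (rev_loop u).
Proof. by apply/pi1_classP/homotopic_rev; apply/pi1_classP; rewrite pi1_repr. Qed.

Fact pi1_mulA : associative pi1_mul.
Proof.
move=> a b c; rewrite -[a]pi1_repr -[b]pi1_repr -[c]pi1_repr !pi1_mulE.
by apply/pi1_classP; exact: homotopic_catA.
Qed.

Fact pi1_mul1 : left_id pi1_one pi1_mul.
Proof.
move=> a; rewrite -[a]pi1_repr pi1_mulE.
by apply/pi1_classP; exact: homotopic_cst_cat.
Qed.

Fact pi1_1mul : right_id pi1_one pi1_mul.
Proof.
move=> a; rewrite -[a]pi1_repr pi1_mulE.
by apply/pi1_classP; exact: homotopic_cat_cst.
Qed.

Fact pi1_mulV : left_inverse pi1_one pi1_inv pi1_mul.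
Proof.
move=> a; rewrite -[a]pi1_repr pi1_invE pi1_mulE.
by apply/pi1_classP; exact: homotopic_rev_cat.
Qed.

Fact pi1_Vmul : right_inverse pi1_one pi1_inv pi1_mul.
Proof.
move=> a; rewrite -[a]pi1_repr pi1_invE pi1_mulE.
by apply/pi1_classP; exact: homotopic_cat_rev.
Qed.

HB.instance Definition _ :=
  isGroup.Build pi1 pi1_mulA pi1_mul1 pi1_1mul pi1_mulV pi1_Vmul.

End FundamentalGroup.

Section InducedMap.
Context (R : realType) (X Y : topologicalType) (p : X) (q : Y).
Context (f : X -> Y) (cf : continuous f) (fp : f p = q).

Local Notation I := (`[0, 1]%classic : set R).

Fact map_loop_cont (u : loop R p) : {within I, continuous (f \o u)}.
Proof.
move=> t; apply: (@continuous_comp (subspace I) X Y); first exact: loop_cont.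
exact: cf.
Qed.

Fact map_loop0 (u : loop R p) : (f \o u) 0 = q.
Proof. by rewrite /= loop0. Qed.

Fact map_loop1 (u : loop R p) : (f \o u) 1 = q.
Proof. by rewrite /= loop1. Qed.

Definition map_loop (u : loop R p) : loop R q :=
  Loop (@map_loop_cont u) (map_loop0 u) (map_loop1 u).

Lemma homotopic_map (u v : loop R p) :
  homotopic u v -> homotopic (map_loop u) (map_loop v).
Proof.
case=> F [cF F0 F1 Fl Fr]; exists (f \o F); split.
- move=> t; apply: (@continuous_comp (subspace (I `*` I)) X Y).
    exact: cF.
  exact: cf.
- by move=> t It /=; rewrite F0.
- by move=> t It /=; rewrite F1.
- by move=> s Is /=; rewrite Fl.
- by move=> s Is /=; rewrite Fr.
Qed.

Definition pi1_map (c : pi1 R p) : pi1 R q := pi1_class (map_loop (repr c)).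

Lemma pi1_mapE (u : loop R p) : pi1_map (pi1_class u) = pi1_class (map_loop u).
Proof. by apply/pi1_classP/homotopic_map/pi1_classP; rewrite pi1_repr. Qed.

Lemma pi1_mapM (c d : pi1 R p) :
  pi1_map (c * d)%g = (pi1_map c * pi1_map d)%g.
Proof.
rewrite -[c]pi1_repr -[d]pi1_repr.
rewrite [(_ * _)%g]pi1_mulE !pi1_mapE [RHS]pi1_mulE; apply/pi1_classP.
apply: (@homotopic_reparam _ _ _ _ _ _ id id) => // [t|t|t _ /=].
- exact: cvg_id.
- exact: cvg_id.
- by rewrite /cat_fun /=; case: ifP.
Qed.

End InducedMap.

Section Groups.
Context (K : groupType).
Implicit Types (S G A B : set K).
Local Open Scope group_scope.

(** Not the library's [[~ a, b]], which is [a^-1 * b^-1 * a * b]. *)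
Definition comm (a b : K) : K := a * b * a^-1 * b^-1.

Definition is_subgroup G : Prop :=
  [/\ G 1, forall a b, G a -> G b -> G (a * b) & forall a, G a -> G a^-1].

Definition gen S : set K := smallest is_subgroup S.

Definition normal_closure S : set K :=
  gen [set g * s * g^-1 | g in [set: K] & s in S].

Definition set_comm A B : set K := gen [set comm a b | a in A & b in B].

Definition set_prod A B : set K := [set a * b | a in A & b in B].

(** [lower_central G n] is the n-th term of the lower central series for
    [1 <= n], with first term [G]. *)
Definition lower_central G (n : nat) : set K := iter n.-1 (set_comm G) G.

Fixpoint double_lcs A B (m : nat) : nat -> set K :=
  match m with
  | 0 => fun n => if n is 0 then [set: K] else lower_central B n
  | m'.+1 => fix Km n := match n with
      | 0 => lower_central A m
      | n'.+1 => set_prod (set_comm A (double_lcs A B m' n))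
                          (set_comm B (Km n'))
      end
  end.

Definition double_lcs_gt A B (m n : nat) : set K :=
  set_prod (double_lcs A B m.+1 n) (double_lcs A B m n.+1).

Definition free_basis (J : Type) (e : J -> K) : Prop :=
  forall (G : groupType) (v : J -> G),
    exists! f : K -> G,
      (forall a b, f (a * b) = f a * f b) /\ forall j, f (e j) = v j.

Lemma gen_subgroup S : is_subgroup (gen S).
Proof.
split.
- by move=> G [[]].
- by move=> a b Sa Sb G SG; have [[_ h _] _] := SG; apply: h; [exact: Sa|exact: Sb].
- by move=> a Sa G SG; have [[_ _ h] _] := SG; apply: h; exact: Sa.
Qed.

Lemma sub_gen S : S `<=` gen S.
Proof. by move=> a Sa G [_]; exact. Qed.

Definition derived : set K := set_comm [set: K] [set: K].

Lemma derivedJ a b : derived a -> derived (b * a * b^-1).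
Proof.
have [_ dM _] := gen_subgroup [set comm a b | a in [set: K] & b in [set: K]].
move=> da; have -> : b * a * b^-1 = comm b a * a by rewrite /comm mulgVK.
by apply: dM => //; apply: sub_gen; exists b => //; exists a.
Qed.

Fact abel_equiv : equiv_class_of (fun a b : K => `[< derived (a * b^-1) >]).
Proof.
have [d1 dM dV] := gen_subgroup [set comm a b | a in [set: K] & b in [set: K]].
split.
- by move=> a; apply/asboolP; rewrite mulgV.
- by move=> a b; apply/asboolP/asboolP => /dV; rewrite invgM invgK.
- move=> b a c /asboolP ab /asboolP bc; apply/asboolP.
  by have := dM _ _ ab bc; rewrite mulgA mulgVK.
Qed.

Canonical abel_rel := EquivRelPack abel_equiv.

Definition abel : Type := {eq_quot abel_rel}.

HB.instance Definition _ := Choice.on abel.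
HB.instance Definition _ := EqQuotient.on abel.

Definition abel_class (a : K) : abel := \pi_(abel) a.

Lemma abel_classP a b : abel_class a = abel_class b <-> derived (a * b^-1).
Proof. by split=> [/eqquotP/asboolP|ab] //; apply/eqquotP/asboolP. Qed.

Lemma abel_repr (c : abel) : abel_class (repr c) = c.
Proof. by rewrite /abel_class reprK. Qed.

Definition abel_zero : abel := abel_class 1.
Definition abel_add (c d : abel) : abel := abel_class (repr c * repr d).
Definition abel_opp (c : abel) : abel := abel_class (repr c)^-1.

Lemma abel_addE a b : abel_add (abel_class a) (abel_class b) = abel_class (a * b).
Proof.
have [d1 dM dV] := gen_subgroup [set comm a b | a in [set: K] & b in [set: K]].
apply/abel_classP.
have /abel_classP da : abel_class (repr (abel_class a)) = abel_class a.
  exact: abel_repr.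
have /abel_classP db : abel_class (repr (abel_class b)) = abel_class b.
  exact: abel_repr.
move: (repr _) da (repr _) db => a' da b' db.
have -> : a' * b' * (a * b)^-1 = (a' * (b' * b^-1) * a'^-1) * (a' * a^-1).
  by rewrite invgM !mulgA mulgVK.
by apply: dM => //; exact: derivedJ.
Qed.

Lemma abel_oppE a : abel_opp (abel_class a) = abel_class a^-1.
Proof.
have [d1 dM dV] := gen_subgroup [set comm a b | a in [set: K] & b in [set: K]].
apply/abel_classP.
have /abel_classP da : abel_class (repr (abel_class a)) = abel_class a.
  exact: abel_repr.
move: (repr _) da => a' /dV; rewrite invgM !invgK => da.
have -> : a'^-1 * a = a'^-1 * (a * a'^-1) * a'^-1^-1 by rewrite invgK mulgA mulgVK.
exact: derivedJ.
Qed.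

Fact abel_addA : associative abel_add.
Proof.
by move=> a b c; rewrite -[a]abel_repr -[b]abel_repr -[c]abel_repr !abel_addE mulgA.
Qed.

Fact abel_addC : commutative abel_add.
Proof.
move=> a b; rewrite -[a]abel_repr -[b]abel_repr !abel_addE.
apply/abel_classP; rewrite invgM mulgA.
by apply: sub_gen; exists (repr a) => //; exists (repr b).
Qed.

Fact abel_add0 : left_id abel_zero abel_add.
Proof. by move=> a; rewrite -[a]abel_repr abel_addE mul1g. Qed.

Fact abel_addN : left_inverse abel_zero abel_opp abel_add.
Proof. by move=> a; rewrite -[a]abel_repr abel_oppE abel_addE mulVg. Qed.

HB.instance Definition _ :=
  GRing.isZmodule.Build abel abel_addA abel_addC abel_add0 abel_addN.

End Groups.

Definition abel_map (K L : groupType) (f : K -> L) (c : abel K) : abel L :=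
  abel_class (f (repr c)).

Lemma abel_mapE (K L : groupType) (f : K -> L) (a : K) :
  (forall a b, f (a * b)%g = (f a * f b)%g) ->
  abel_map f (abel_class a) = abel_class (f a).
Proof.
move=> fM.
have f1 : f 1%g = 1%g by apply: (@mulgI _ (f 1%g)); rewrite -fM !mulg1.
have fV b : f (b^-1)%g = (f b)^-1%g.
  by apply: (@mulgI _ (f b)); rewrite -fM !mulgV.
have /abel_classP da : abel_class (repr (abel_class a)) = abel_class a.
  exact: abel_repr.
apply/abel_classP; rewrite -fV -fM.
pose P := [set b | derived (f b)].
have [d1 dM dV] := gen_subgroup [set comm a b | a in [set: L] & b in [set: L]].
apply: (da P); split; first split.
- by rewrite /P /= f1.
- by move=> b c Pb Pc; rewrite /P /= fM; exact: dM.
- by move=> b Pb; rewrite /P /= fV; exact: dV.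
- move=> _ [b _ [c _ <-]]; apply: sub_gen; exists (f b) => //.
  by exists (f c) => //; rewrite /comm !fM !fV.
Qed.

HB.mixin Record isLieRing L of GRing.Zmodule L := {
  lie : L -> L -> L;
  lieDl : forall u v w, lie (u + v) w = lie u w + lie v w;
  lieDr : forall u v w, lie u (v + w) = lie u v + lie u w;
  lie_alt : forall u, lie u u = 0;
  lie_jacobi : forall u v w,
    lie u (lie v w) + lie v (lie w u) + lie w (lie u v) = 0 }.

#[short(type="lieRingType")]
HB.structure Definition LieRing := { L of GRing.Zmodule L & isLieRing L }.

Section FreeLie.
Context (H : zmodType).

(** The Lie ring freely generated by the abelian group [H]: formal Lie
    expressions in elements of [H], identified when they take the same value
    in every Lie ring for every additive assignment of the generators. *)
Inductive lie_term :=
  | LieGen of H | LieZero | LieAdd of lie_term & lie_term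
  | LieOpp of lie_term | LieBr of lie_term & lie_term.

HB.instance Definition _ := gen_eqMixin lie_term.
HB.instance Definition _ := gen_choiceMixin lie_term.

Fixpoint lie_eval (M : lieRingType) (f : H -> M) (t : lie_term) : M :=
  match t with
  | LieGen c => f c
  | LieZero => 0
  | LieAdd s t => lie_eval f s + lie_eval f t
  | LieOpp t => - lie_eval f t
  | LieBr s t => lie (lie_eval f s) (lie_eval f t)
  end.

Definition lie_term_eq (s t : lie_term) : Prop :=
  forall (M : lieRingType) (f : {additive H -> M}), lie_eval f s = lie_eval f t.

Fact lie_term_equiv : equiv_class_of (fun s t => `[< lie_term_eq s t >]).
Proof.
split.
- by move=> s; apply/asboolP.
- by move=> s t; apply/asboolP/asboolP => h M f; rewrite h.
- move=> t s u /asboolP st /asboolP tu; apply/asboolP => M f.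
  by rewrite st.
Qed.

Canonical lie_term_rel := EquivRelPack lie_term_equiv.

Definition free_lie : Type := {eq_quot lie_term_rel}.

HB.instance Definition _ := Choice.on free_lie.
HB.instance Definition _ := EqQuotient.on free_lie.

Definition fl_class (t : lie_term) : free_lie := \pi_(free_lie) t.

Lemma fl_classP s t : fl_class s = fl_class t <-> lie_term_eq s t.
Proof. by split=> [/eqquotP/asboolP|st] //; apply/eqquotP/asboolP. Qed.

Lemma fl_repr (u : free_lie) : fl_class (repr u) = u.
Proof. by rewrite /fl_class reprK. Qed.

Lemma fl_reprE t : lie_term_eq (repr (fl_class t)) t.
Proof. by apply/fl_classP; rewrite fl_repr. Qed.

Definition fl_zero : free_lie := fl_class LieZero.
Definition fl_add (u v : free_lie) := fl_class (LieAdd (repr u) (repr v)).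
Definition fl_opp (u : free_lie) := fl_class (LieOpp (repr u)).
Definition fl_lie (u v : free_lie) := fl_class (LieBr (repr u) (repr v)).

Lemma fl_addE s t : fl_add (fl_class s) (fl_class t) = fl_class (LieAdd s t).
Proof. by apply/fl_classP => M f /=; rewrite !(fl_reprE _ f). Qed.

Lemma fl_oppE t : fl_opp (fl_class t) = fl_class (LieOpp t).
Proof. by apply/fl_classP => M f /=; rewrite !(fl_reprE _ f). Qed.

Lemma fl_lieE s t : fl_lie (fl_class s) (fl_class t) = fl_class (LieBr s t).
Proof. by apply/fl_classP => M f /=; rewrite !(fl_reprE _ f). Qed.

Local Ltac fl_solve :=
  rewrite ?(fl_addE, fl_oppE, fl_lieE); apply/fl_classP => M f /=.

Fact fl_addA : associative fl_add.
Proof.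
move=> u v w; rewrite -[u]fl_repr -[v]fl_repr -[w]fl_repr.
by fl_solve; rewrite addrA.
Qed.

Fact fl_addC : commutative fl_add.
Proof. by move=> u v; rewrite -[u]fl_repr -[v]fl_repr; fl_solve; rewrite addrC. Qed.

Fact fl_add0 : left_id fl_zero fl_add.
Proof. by move=> u; rewrite -[u]fl_repr; fl_solve; rewrite add0r. Qed.

Fact fl_addN : left_inverse fl_zero fl_opp fl_add.
Proof. by move=> u; rewrite -[u]fl_repr; fl_solve; rewrite addNr. Qed.

HB.instance Definition _ :=
  GRing.isZmodule.Build free_lie fl_addA fl_addC fl_add0 fl_addN.

Fact fl_lieDl (u v w : free_lie) : fl_lie (u + v) w = fl_lie u w + fl_lie v w.
Proof.
rewrite -[u]fl_repr -[v]fl_repr -[w]fl_repr.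
by rewrite /GRing.add /=; fl_solve; rewrite lieDl.
Qed.

Fact fl_lieDr (u v w : free_lie) : fl_lie u (v + w) = fl_lie u v + fl_lie u w.
Proof.
rewrite -[u]fl_repr -[v]fl_repr -[w]fl_repr.
by rewrite /GRing.add /=; fl_solve; rewrite lieDr.
Qed.

Fact fl_lie_alt (u : free_lie) : fl_lie u u = 0.
Proof. by rewrite -[u]fl_repr; fl_solve; rewrite lie_alt. Qed.

Fact fl_jacobi (u v w : free_lie) :
  fl_lie u (fl_lie v w) + fl_lie v (fl_lie w u) + fl_lie w (fl_lie u v) = 0.
Proof.
rewrite -[u]fl_repr -[v]fl_repr -[w]fl_repr.
by rewrite /GRing.add /=; fl_solve; rewrite lie_jacobi.
Qed.

HB.instance Definition _ :=
  isLieRing.Build free_lie fl_lieDl fl_lieDr fl_lie_alt fl_jacobi.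

Definition fl_gen (c : H) : free_lie := fl_class (LieGen c).

Lemma fl_genD (c d : H) : fl_gen (c + d) = fl_gen c + fl_gen d.
Proof. by rewrite /GRing.add /=; fl_solve; rewrite raddfD. Qed.

Definition lie_morphism (L M : lieRingType) (f : L -> M) : Prop :=
  (forall u v, f (u + v) = f u + f v) /\
  (forall u v, f (lie u v) = lie (f u) (f v)).

Lemma free_lie_universal (M : lieRingType) (f : {additive H -> M}) :
  exists! F : free_lie -> M, lie_morphism F /\ forall c, F (fl_gen c) = f c.
Proof.
exists (fun u => lie_eval f (repr u)); split.
  split; [split|] => [u v|u v|c].
  - exact: (fl_reprE (LieAdd (repr u) (repr v)) f).
  - exact: (fl_reprE (LieBr (repr u) (repr v)) f).
  - exact: (fl_reprE (LieGen c) f).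
move=> F [[FD FL] FG]; apply/funext => u; rewrite -[u in RHS]fl_repr.
have F0 : F 0 = 0 by apply: (addrI (F 0)); rewrite -FD !addr0.
elim: (repr u) => [c||s IHs t IHt|t IHt|s IHs t IHt] /=.
- by rewrite -FG.
- by rewrite -F0.
- by rewrite IHs IHt -FD; congr F; exact: fl_addE.
- rewrite IHt; apply/eqP; rewrite eq_sym -addr_eq0 -FD -F0; apply/eqP.
  congr F; rewrite -fl_oppE; exact: addNr.
- by rewrite IHs IHt -FL; congr F; exact: fl_lieE.
Qed.

(** [bidegree A B m n]: the homogeneous component of bidegree [(m, n)], for
    [A] in degree [(1, 0)] and [B] in degree [(0, 1)]. *)
Inductive bidegree (A B : set H) : nat -> nat -> free_lie -> Prop :=
  | bidegA c : A c -> bidegree A B 1 0 (fl_gen c)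
  | bidegB c : B c -> bidegree A B 0 1 (fl_gen c)
  | bideg0 m n : bidegree A B m n 0
  | bidegD m n u v : bidegree A B m n u -> bidegree A B m n v ->
      bidegree A B m n (u + v)
  | bidegN m n u : bidegree A B m n u -> bidegree A B m n (- u)
  | bideg_lie i j k l u v : bidegree A B i j u -> bidegree A B k l v ->
      bidegree A B (i + k) (j + l) (lie u v).

End FreeLie.

Section Tensor.
Context (U V : zmodType).

Definition biadditive (W : zmodType) (f : U -> V -> W) : Prop :=
  (forall u u' v, f (u + u') v = f u v + f u' v) /\
  (forall u v v', f u (v + v') = f u v + f u v').

(** Formal sums of pure tensors, identified when they take the same value
    under every biadditive map. *)
Definition tens_eval (W : zmodType) (f : U -> V -> W) (s : seq (U * V)) : W :=
  \sum_(c <- s) f c.1 c.2.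

Definition tens_eq (s t : seq (U * V)) : Prop :=
  forall (W : zmodType) (f : U -> V -> W),
    biadditive f -> tens_eval f s = tens_eval f t.

Fact tens_equiv : equiv_class_of (fun s t => `[< tens_eq s t >]).
Proof.
split.
- by move=> s; apply/asboolP.
- by move=> s t; apply/asboolP/asboolP => h W f bf; rewrite h.
- move=> t s u /asboolP st /asboolP tu; apply/asboolP => W f bf.
  by rewrite st // tu.
Qed.

Canonical tens_rel := EquivRelPack tens_equiv.

Definition tensor : Type := {eq_quot tens_rel}.

HB.instance Definition _ := Choice.on tensor.
HB.instance Definition _ := EqQuotient.on tensor.

Definition tens_class (s : seq (U * V)) : tensor := \pi_(tensor) s.

Lemma tens_classP s t : tens_class s = tens_class t <-> tens_eq s t.
Proof. by split=> [/eqquotP/asboolP|st] //; apply/eqquotP/asboolP. Qed.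

Lemma tens_repr (x : tensor) : tens_class (repr x) = x.
Proof. by rewrite /tens_class reprK. Qed.

Lemma tens_reprE s : tens_eq (repr (tens_class s)) s.
Proof. by apply/tens_classP; rewrite tens_repr. Qed.

Definition tens_oppseq (s : seq (U * V)) := [seq (- c.1, c.2) | c <- s].

Lemma tens_evalD (W : zmodType) (f : U -> V -> W) s t :
  tens_eval f (s ++ t) = tens_eval f s + tens_eval f t.
Proof. by rewrite /tens_eval big_cat. Qed.

Lemma tens_evalN (W : zmodType) (f : U -> V -> W) s :
  biadditive f -> tens_eval f (tens_oppseq s) = - tens_eval f s.
Proof.
move=> [fDl fDr].
have f0 v : f 0 v = 0 by apply: (addrI (f 0 v)); rewrite -fDl !addr0.
rewrite /tens_eval /tens_oppseq big_map -sumrN; apply: eq_bigr => -[u v] _ /=.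
by apply/eqP; rewrite -addr_eq0 -fDl addNr f0.
Qed.

Definition tens_zero : tensor := tens_class [::].
Definition tens_add (x y : tensor) := tens_class (repr x ++ repr y).
Definition tens_opp (x : tensor) := tens_class (tens_oppseq (repr x)).

Lemma tens_addE s t : tens_add (tens_class s) (tens_class t) = tens_class (s ++ t).
Proof.
by apply/tens_classP => W f bf; rewrite !tens_evalD !(tens_reprE _ bf).
Qed.

Lemma tens_oppE s : tens_opp (tens_class s) = tens_class (tens_oppseq s).
Proof.
by apply/tens_classP => W f bf; rewrite !tens_evalN // (tens_reprE _ bf).
Qed.

Fact tens_addA : associative tens_add.
Proof.
by move=> x y z; rewrite -[x]tens_repr -[y]tens_repr -[z]tens_repr !tens_addE catA.
Qed.

Fact tens_addC : commutative tens_add.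
Proof.
move=> x y; rewrite -[x]tens_repr -[y]tens_repr !tens_addE.
by apply/tens_classP => W f bf; rewrite !tens_evalD addrC.
Qed.

Fact tens_add0 : left_id tens_zero tens_add.
Proof. by move=> x; rewrite -[x]tens_repr tens_addE. Qed.

Fact tens_addN : left_inverse tens_zero tens_opp tens_add.
Proof.
move=> x; rewrite -[x]tens_repr tens_oppE tens_addE.
apply/tens_classP => W f bf; rewrite tens_evalD tens_evalN // addNr.
by rewrite /tens_eval big_nil.
Qed.

HB.instance Definition _ :=
  GRing.isZmodule.Build tensor tens_addA tens_addC tens_add0 tens_addN.

Definition tens (u : U) (v : V) : tensor := tens_class [:: (u, v)].

Definition tens_lift (W : zmodType) (f : U -> V -> W) (x : tensor) : W :=
  tens_eval f (repr x).

Lemma tens_biadditive : biadditive tens.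
Proof.
by split=> [u u' v|u v v']; rewrite /tens [RHS]tens_addE;
  apply/tens_classP => W f [fDl fDr];
  rewrite tens_evalD /tens_eval !big_seq1 /= ?fDl ?fDr.
Qed.

Lemma tens_liftD (W : zmodType) (f : U -> V -> W) : biadditive f ->
  forall x y, tens_lift f (x + y) = tens_lift f x + tens_lift f y.
Proof. by move=> bf x y; rewrite /tens_lift (tens_reprE _ bf) tens_evalD. Qed.

Lemma tens_lift_tens (W : zmodType) (f : U -> V -> W) : biadditive f ->
  forall u v, tens_lift f (tens u v) = f u v.
Proof.
by move=> bf u v; rewrite /tens_lift (tens_reprE _ bf) /tens_eval big_seq1.
Qed.

End Tensor.

Definition homeomorphic (X Y : topologicalType) : Prop :=
  exists (f : X -> Y) (g : Y -> X),
    [/\ continuous f, continuous g, cancel f g & cancel g f].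

Definition set_incl (T : Type) (A B : set T) (AB : A `<=` B) (z : A) : B :=
  exist _ (\val z) (mem_set (AB _ (set_mem (valP z)))).

Lemma set_incl_cont (T : topologicalType) (A B : set T) (AB : A `<=` B) :
  continuous (set_incl AB).
Proof.
apply: continuous_comp_initial.
exact: (@initial_continuous A T set_val).
Qed.

Section Spaces.
Context (R : realType).

Definition sqnorm n (v : 'rV[R]_n) : R := \sum_i v 0 i ^+ 2.

Definition closed_disk : set 'rV[R]_2 := [set v | sqnorm v <= 1].

Definition sphere3 : set 'rV[R]_4 := [set v | sqnorm v = 1].

(** The handlebody of genus [g]: a rectangle with [g] disjoint open unit disks,
    centered at the points [(4 i, 0)], removed, times the unit interval. *)
Definition handlebody (g : nat) : set 'rV[R]_3 := [set v |
  [/\ -2 <= v 0 0 <= 4 * g%:R + 2, -2 <= v 0 1 <= 2, 0 <= v 0 2 <= 1 &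
      forall i : 'I_g, 1 <= (v 0 0 - 4 * i%:R) ^+ 2 + v 0 1 ^+ 2]].

(** For a handlebody in [sphere3], the manifold boundary is the frontier, by
    invariance of domain. *)
Definition bdry (V : set 'rV[R]_4) : set 'rV[R]_4 :=
  V `&` closure (sphere3 `\` V).

Definition heegaard_splitting (g : nat) (V V' : set 'rV[R]_4) : Prop :=
  [/\ V `|` V' = sphere3, homeomorphic V (handlebody g),
      homeomorphic V' (handlebody g), V `&` V' = bdry V & V `&` V' = bdry V'].

(** [surf V D] is the complement of the interior of the disk [D] in the
    boundary of [V]; its own boundary is [surf V D `&` D]. *)
Definition surf (V D : set 'rV[R]_4) : set 'rV[R]_4 :=
  bdry V `&` closure (bdry V `\` D).

Record pointed_splitting (g : nat) := PointedSplitting {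
  psV : set 'rV[R]_4;
  psV' : set 'rV[R]_4;
  psD : set 'rV[R]_4;
  ps_splitting : heegaard_splitting g psV psV';
  psD_bdry : psD `<=` bdry psV;
  psD_disk : homeomorphic psD closed_disk;
  ps_base : surf psV psD;
  ps_base_bdry : psD (\val ps_base) }.

End Spaces.

Section Surface.
Context (R : realType) (g : nat) (S : pointed_splitting R g).

Definition Sigma : set 'rV[R]_4 := surf (psV S) (psD S).

Definition dSigma : set Sigma := [set z | psD S (\val z)].

Definition basept : Sigma := ps_base S.

Lemma Sigma_V : Sigma `<=` psV S.
Proof. by move=> v [[]]. Qed.

Lemma Sigma_V' : Sigma `<=` psV' S.
Proof.
move=> v [+ _]; have [_ _ _ <- _] := ps_splitting S.
by case.
Qed.

Definition baseV : psV S := set_incl Sigma_V basept.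
Definition baseV' : psV' S := set_incl Sigma_V' basept.

Definition K : groupType := pi1 R basept.

Definition inV : K -> pi1 R baseV :=
  pi1_map (set_incl_cont (AB:=Sigma_V)) (erefl baseV).

Definition inV' : K -> pi1 R baseV' :=
  pi1_map (set_incl_cont (AB:=Sigma_V')) (erefl baseV').

Definition Xbar : set K := [set k | inV k = 1%g].
Definition Ybar : set K := [set k | inV' k = 1%g].

Definition Kmn : nat -> nat -> set K := double_lcs Xbar Ybar.
Definition Kgt : nat -> nat -> set K := double_lcs_gt Xbar Ybar.

(** A homeomorphism of [Sigma] that is the identity on its nonempty boundary
    preserves the orientation, so this need not be required. *)
Record bd_homeo := BdHomeo {
  bdh_fun :> Sigma -> Sigma;
  bdh_inv : Sigma -> Sigma;
  bdh_cont : continuous bdh_fun;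
  bdh_inv_cont : continuous bdh_inv;
  bdh_funK : cancel bdh_fun bdh_inv;
  bdh_invK : cancel bdh_inv bdh_fun;
  bdh_bdry : forall z, dSigma z -> bdh_fun z = z }.

Definition isotopic (h k : bd_homeo) : Prop :=
  exists F : R -> bd_homeo,
    [/\ {within `[0, 1]%classic `*` setT,
           continuous (fun z : R * Sigma => F z.1 z.2)},
        F 0 =1 h & F 1 =1 k].

Definition isotopy_class (h : bd_homeo) : set bd_homeo := [set k | isotopic h k].

Definition mapping_class : Type :=
  {c : set bd_homeo | exists h, c = isotopy_class h}.

Definition mapping_class_repr (h : mapping_class) : bd_homeo :=
  projT1 (cid (svalP h)).

Definition bdh_act (h : bd_homeo) : K -> K :=
  pi1_map (@bdh_cont h) (@bdh_bdry h basept (ps_base_bdry S)).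

Definition mcg_act (h : mapping_class) : K -> K :=
  bdh_act (mapping_class_repr h).

Lemma isotopic_act (h k : bd_homeo) : isotopic h k -> bdh_act h = bdh_act k.
Proof.
case=> F [cF F0 F1]; apply/funext => c; rewrite -[c]pi1_repr.
rewrite /bdh_act !pi1_mapE; apply/pi1_classP.
set u := repr c.
exists (fun z : R * R => F z.1 (u z.2)); split.
- have cu := loop_cont (l := u).
  apply/subspace_continuousP => -[s t] [/= Is It].
  move/subspace_continuousP: cF => /(_ (s, u t)) cF.
  have /cF : (`[0, 1]%classic `*` setT) (s, u t) by split.
  apply: cvg_trans => /=.
  move=> W /= [] /= [P Q] [/= Ps Qt] PQW.
  have /subspace_continuousP/(_ t It Q Qt) := cu.
  rewrite nbhs_simpl /within /= => uQ.
  exists (P, fun t => `[0, 1]%classic t -> Q (u t)); first by split.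
  move=> [s' t'] [/= Ps' Qt'] [/= Is' It'].
  by apply: (PQW (s', u t')); split => //=; exact: Qt'.
- by move=> t _ /=; rewrite F0.
- by move=> t _ /=; rewrite F1.
- by move=> s _ /=; rewrite loop0; apply: bdh_bdry; exact: ps_base_bdry.
- by move=> s _ /=; rewrite loop1; apply: bdh_bdry; exact: ps_base_bdry.
Qed.

Lemma mcg_actE (h : mapping_class) (k : bd_homeo) :
  sval h k -> mcg_act h = bdh_act k.
Proof.
rewrite /mcg_act /mapping_class_repr; case: cid => h0 /= ->.
exact: isotopic_act.
Qed.

Definition mcg_comm (h : mapping_class) (k : K) : K := (mcg_act h k * k^-1)%g.

Definition double_johnson (m n : nat) : set mapping_class := [set h |
  [/\ mcg_act h @` Xbar = Xbar, mcg_act h @` Ybar = Ybar,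
      mcg_comm h @` Xbar `<=` Kmn m.+1 n & mcg_comm h @` Ybar `<=` Kmn m n.+1]].

(** [u] runs once around the boundary of [Sigma]. *)
Definition boundary_loop (u : loop R basept) : Prop :=
  u @` `[0, 1]%classic = dSigma /\ {in `[0, 1[%classic &, injective u}.

(** The kernels [Xbar] and [Ybar] being normally generated by the [x i] and by
    the [y i] says in particular that the [x i] die in [V] and the [y i] in [V'];
    a splitting with such a pair of systems is the standard one. *)
Definition standard_basis (x y : 'I_g -> K) : Prop :=
  [/\ free_basis (fun j : 'I_g + 'I_g =>
                    match j with inl i => x i | inr i => y i end),
      Xbar = normal_closure (range x), Ybar = normal_closure (range y) &
      exists u : loop R basept, boundary_loop u /\
        ((pi1_class u)^-1)%g
        = (\big[*%g/1]_(i < g) comm (x i)^-1 (y i)^-1)%g].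

(** First homology groups are abelianized fundamental groups. *)
Definition H1 : zmodType := abel K.

Definition LagA : set H1 := [set c | abel_map inV c = 0].
Definition LagB : set H1 := [set c | abel_map inV' c = 0].

Definition LieAB : lieRingType := free_lie H1.

Definition Lie (m n : nat) : set LieAB := bidegree LagA LagB m n.

Definition gens (x : 'I_g -> K) (i : 'I_g) : H1 := abel_class (x i).

Definition Npos (m n : nat) : Prop := (m, n) <> (0%N, 0%N).

(** The identification of the graded Lie ring of the double lower central
    series with the free Lie ring: [theta m n z] is the element of [Lie m n]
    corresponding to the coset of [z] modulo [Kgt m n], for [z] in [Kmn m n]. *)
Record lie_identification (x y : 'I_g -> K) (theta : nat -> nat -> K -> LieAB)
    : Prop := LieIdentification {
  theta_Lie : forall m n, Npos m n -> theta m n @` Kmn m n = Lie m n;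
  thetaM : forall m n, Npos m n -> forall z w, Kmn m n z -> Kmn m n w ->
    theta m n (z * w)%g = theta m n z + theta m n w;
  theta_ker : forall m n, Npos m n -> forall z, Kmn m n z ->
    (theta m n z = 0 <-> Kgt m n z);
  theta_lie : forall i j k l, Npos i j -> Npos k l ->
    forall z w, Kmn i j z -> Kmn k l w ->
    theta (i + k)%N (j + l)%N (comm z w) = lie (theta i j z) (theta k l w);
  theta_x : forall i, theta 1 0 (x i) = fl_gen (gens x i);
  theta_y : forall i, theta 0 1 (y i) = fl_gen (gens y i) }.

Definition derivation (m n : nat) (d : LieAB -> LieAB) : Prop :=
  [/\ forall u v, d (u + v) = d u + d v,
      forall u v, d (lie u v) = lie (d u) v + lie u (d v) &
      forall i j, Npos i j -> d @` Lie i j `<=` Lie (m + i) (n + j)].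

Definition Omega (x y : 'I_g -> K) : LieAB :=
  \sum_i lie (fl_gen (gens x i)) (fl_gen (gens y i)).

Definition symplectic_derivation (x y : 'I_g -> K) (m n : nat)
    (d : LieAB -> LieAB) : Prop :=
  derivation m n d /\ d (Omega x y) = 0.

Notation HLie := (tensor H1 LieAB).

(** [(LagA (x) Lie m n.+1) (+) (LagB (x) Lie m.+1 n)], as a subgroup of
    [H1 (x) LieAB]. *)
Inductive tensor_part (m n : nat) : HLie -> Prop :=
  | tpA a u : LagA a -> Lie m n.+1 u -> tensor_part m n (tens a u)
  | tpB b u : LagB b -> Lie m.+1 n u -> tensor_part m n (tens b u)
  | tp0 : tensor_part m n 0
  | tpD s t : tensor_part m n s -> tensor_part m n t -> tensor_part m n (s + t)
  | tpN t : tensor_part m n t -> tensor_part m n (- t).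

Definition Xi : HLie -> LieAB := tens_lift (fun (c : H1) u => lie (fl_gen c) u).

Definition Dmn (m n : nat) : set HLie := [set t | tensor_part m n t /\ Xi t = 0].

(** A derivation restricts to a pair of maps on [LagA] and [LagB]; these become
    tensors through [LagA = LagB^*] and [LagB = LagA^*], [z |-> omega(z, .)],
    where [omega] is the intersection form, for which the [gens x i] and
    [gens y i] form a symplectic basis. *)
Definition derivation_tensor (x y : 'I_g -> K) (d : LieAB -> LieAB) : HLie :=
  \sum_i tens (gens x i) (d (fl_gen (gens y i)))
  - \sum_i tens (gens y i) (d (fl_gen (gens x i))).

Definition tau_tensor (x y : 'I_g -> K) (theta : nat -> nat -> K -> LieAB)
    (m n : nat) (h : mapping_class) : HLie :=
  \sum_i tens (gens x i) (theta m n.+1 (mcg_comm h (y i)))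
  - \sum_i tens (gens y i) (theta m.+1 n (mcg_comm h (x i))).

Definition is_tau (theta : nat -> nat -> K -> LieAB) (m n : nat)
    (h : mapping_class) (d : LieAB -> LieAB) : Prop :=
  derivation m n d /\
  forall i j, Npos i j -> forall z, Kmn i j z ->
    Kmn (m + i) (n + j) (mcg_comm h z) /\
    d (theta i j z) = theta (m + i)%N (n + j)%N (mcg_comm h z).

End Surface.

(* Main.v *)
(** Write [[h, z] = h(z) z^-1]. Hall-Witt's identity makes the double lower
    central series a bifiltration that is compatible with commutators, and an
    induction on commutators gives [[h, K_(i,j)] <= K_(m+i,n+j)]. Modulo
    [K_>], [[h, [a, b]]] is [[[h, a], b] [a, [h, b]]], so that [h] induces a
    derivation [tau(h)] of the associated graded Lie ring; on the free Lie ring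
    it is obtained by extending its values on the generators to a derivation,
    and it is determined by them.

    Since [h] is the identity on the boundary of the surface, it fixes
    [zeta = prod_i [x_i^-1, y_i^-1]]. The class of [zeta] in degree [(1, 1)] is
    [Omega], because the two signs cancel; hence [tau(h)(Omega)] is the class
    of [[h, zeta] = 1], that is [0]. By Leibniz' rule [d(Omega)] is the image
    under [Xi] of the tensor of [d]. *)

Require Import Defs.
From HB Require Import structures.
From mathcomp Require Import all_boot all_order all_algebra.
From mathcomp Require Import all_classical all_reals topology normedtype.
From mathcomp Require Import zify.
Set Implicit Arguments.
Unset Strict Implicit.
Unset Printing Implicit Defensive.
Import Order.TTheory GRing.Theory Num.Theory.
Import numFieldNormedType.Exports.
Local Open Scope classical_set_scope.
Local Open Scope ring_scope.

(** Free reduction of words: inverses are pushed down to the letters, products reassociated to the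
    left, and adjacent inverse letters cancelled. *)
Local Ltac group_eq :=
  rewrite /comm ?(invg1, invgM, invgK, mulgA) ?(mulgK, mulgVK, mulgV, mulVg, mul1g, mulg1).

(** * Commutator calculus in a group *)

Section Commutators.
Context (G : groupType).
Implicit Types (A B C N : set G) (a b c g : G).
Local Open Scope group_scope.

Definition is_normal N : Prop :=
  is_subgroup N /\ forall g a, N a -> N (g * a * g^-1).

Lemma subgroup1 N : is_subgroup N -> N 1. Proof. by case. Qed.

Lemma subgroupM N a b : is_subgroup N -> N a -> N b -> N (a * b).
Proof. by move=> [_ NM _]; exact: NM. Qed.

Lemma subgroupV N a : is_subgroup N -> N a -> N a^-1.
Proof. by move=> [_ _]; exact. Qed.

Lemma comm_inv a b : (comm a b)^-1 = comm b a.
Proof. by group_eq. Qed.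

Lemma commMl a b c : comm (a * b) c = a * comm b c * a^-1 * comm a c.
Proof. by group_eq. Qed.

Lemma commVl a b : comm a^-1 b = a^-1 * comm b a * a^-1^-1.
Proof. by group_eq. Qed.

Lemma conj_comm g a b :
  g * comm a b * g^-1 = comm (g * a * g^-1) (g * b * g^-1).
Proof. by group_eq. Qed.

(** An identity of free groups. The conjugations sit on the second entries, where normality of the
    subgroups absorbs them. *)
Lemma hall_witt a b c :
  comm (comm a b) (b * c * b^-1) * comm (comm b c) (c * a * c^-1)
    * comm (comm c a) (a * b * a^-1) = 1.
Proof. by group_eq. Qed.

Lemma gen_min (S N : set G) : is_subgroup N -> S `<=` N -> gen S `<=` N.
Proof. by move=> sN SN a; apply. Qed.

Lemma set_comm_min A B N : is_subgroup N ->
  (forall a b, A a -> B b -> N (comm a b)) -> set_comm A B `<=` N.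
Proof. by move=> sN ABN; apply: gen_min => // _ [a Aa [b Bb <-]]; exact: ABN. Qed.

Lemma mem_set_comm A B a b : A a -> B b -> set_comm A B (comm a b).
Proof. by move=> Aa Bb; apply: sub_gen; exists a => //; exists b. Qed.

Lemma set_comm_normal A B : is_normal A -> is_normal B -> is_normal (set_comm A B).
Proof.
move=> [_ AJ] [_ BJ]; have sAB := gen_subgroup [set comm a b | a in A & b in B].
split=> // g a ABa; have [s1 sM sV] := sAB.
suff: set_comm A B `<=` [set z | set_comm A B (g * z * g^-1)] by apply.
apply: set_comm_min => [|a' b' Aa Bb]; last first.
  by rewrite /= conj_comm; apply: mem_set_comm; [exact: AJ|exact: BJ].
split=> /= [|u v Hu Hv|u /sV]; first by rewrite mulg1 mulgV.
  by have := sM _ _ Hu Hv; group_eq.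
by group_eq.
Qed.

Lemma set_prod_normal A B : is_normal A -> is_normal B -> is_normal (set_prod A B).
Proof.
move=> [[A1 AM AV] AJ] [[B1 BM BV] BJ]; split; first split.
- by exists 1 => //; exists 1 => //; rewrite mulg1.
- move=> _ _ [a Aa [b Bb <-]] [a' Aa' [b' Bb' <-]].
  exists (a * (b * a' * b^-1)); first by apply: AM => //; exact: AJ.
  by exists (b * b'); [exact: BM|group_eq].
- move=> _ [a Aa [b Bb <-]]; exists (b^-1 * a^-1 * b).
    by have := AJ b^-1 a^-1 (AV _ Aa); rewrite invgK.
  by exists b^-1; [exact: BV|group_eq].
- move=> g _ [a Aa [b Bb <-]]; exists (g * a * g^-1); first exact: AJ.
  by exists (g * b * g^-1); [exact: BJ|group_eq].
Qed.

Lemma set_prod_min A B N : is_subgroup N -> A `<=` N -> B `<=` N ->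
  set_prod A B `<=` N.
Proof.
by move=> [_ NM _] AN BN _ [a Aa [b Bb <-]]; apply: NM; [exact: AN|exact: BN].
Qed.

Lemma set_prodl A B : B 1 -> A `<=` set_prod A B.
Proof. by move=> B1 a Aa; exists a => //; exists 1 => //; rewrite mulg1. Qed.

Lemma set_prodr A B : A 1 -> B `<=` set_prod A B.
Proof. by move=> A1 b Bb; exists 1 => //; exists b => //; rewrite mul1g. Qed.

(** By Hall-Witt, [comm (comm a b) c] is the inverse of a product of two commutators of the other
    two cyclic shapes. *)
Lemma three_subgroups A B C N : is_normal A -> is_normal B -> is_normal C -> is_normal N ->
  (forall b c a, B b -> C c -> A a -> N (comm (comm b c) a)) ->
  (forall c a b, C c -> A a -> B b -> N (comm (comm c a) b)) ->
  forall a b c, A a -> B b -> C c -> N (comm (comm a b) c).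
Proof.
move=> [_ AJ] [_ BJ] [_ CJ] [[N1 NM NV] NJ] NBC NCA a b c Aa Bb Cc.
(* In Hall-Witt the third letter appears next to [comm a b] conjugated by [b]; this choice makes
   that conjugate equal to [c]. *)
pose c' := b^-1 * c * b.
have Cc' : C c' by have := CJ b^-1 c Cc; rewrite invgK.
have -> : c = b * c' * b^-1 by rewrite /c'; group_eq.
have := hall_witt a b c'.
set u := comm (comm b c') _; set v := comm (comm c' a) _.
set w := comm (comm a b) _ => E.
have Nu : N u by apply: NBC => //; exact: AJ.
have Nv : N v by apply: NCA => //; exact: BJ.
have -> : w = (u * v)^-1.
  by apply: (mulIg (u * v)); rewrite mulVg mulgA.
by apply/NV/NM.
Qed.

End Commutators.

(** * The double lower central series as a bifiltration *)

Section DoubleLowerCentralSeries.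
Context (G : groupType) (A B : set G) (nA : is_normal A) (nB : is_normal B).
Local Open Scope group_scope.

Local Notation D := (double_lcs A B).
Local Notation Dgt := (double_lcs_gt A B).

Lemma double_lcs_normal m n : is_normal (D m n).
Proof.
elim: m n => [|m IHm]; elim=> [|n IHn].
- by split; first split.
(* On the axis, [D 0 1] is [B] itself; from there on, each term is by definition the commutator of
   [B] with the preceding one. *)
- by case: n IHn => // n IHn; exact: set_comm_normal.
- by case: m IHm => // m IHm; exact: (set_comm_normal nA (IHm 0%N)).
- by apply: set_prod_normal; apply: set_comm_normal.
Qed.

Let Ds m n : is_subgroup (D m n). Proof. by have [] := double_lcs_normal m n. Qed.
Let DJ m n := (double_lcs_normal m n).2.

(** For [n > 0] this is the left factor of the defining product; for [n = 0] it is the next term of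
    the lower central series of [A], except at [(0, 0)], where [z] is arbitrary and normality of [A]
    is used. *)
Lemma comm_double_lcsl m n a z : A a -> D m n z -> D m.+1 n (comm a z).
Proof.
case: n => [|n] Aa Dz; last first.
  by apply: (@set_prodl _ _ _ (subgroup1 (gen_subgroup _))); exact: mem_set_comm.
case: m Dz => [|m] Dz; last exact: mem_set_comm.
have [[_ AM AV] AJ] := nA.
have -> : comm a z = a * (z * a^-1 * z^-1) by group_eq.
by apply: AM => //; apply/AJ/AV.
Qed.

Lemma comm_double_lcsr m n b z : B b -> D m n z -> D m n.+1 (comm b z).
Proof.
case: m => [|m] Bb Dz; last first.
  by apply: (@set_prodr _ _ _ (subgroup1 (gen_subgroup _))); exact: mem_set_comm.
case: n Dz => [|n] Dz; last exact: mem_set_comm.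
have [[_ BM BV] BJ] := nB.
have -> : comm b z = b * (z * b^-1 * z^-1) by group_eq.
by apply: BM => //; apply/BJ/BV.
Qed.

(** Induction on commutators: away from [(0, 0)], every term of the series is built from [A] and [B]
    by taking commutators with [A] or [B], generated subgroups and products. The term at [(0, 0)] is
    the whole group and is not obtained this way. *)
Lemma double_lcs_ind (P : nat -> nat -> set G) :
  (forall i j, Npos i j -> is_subgroup (P i j)) ->
  A `<=` P 1%N 0%N -> B `<=` P 0%N 1%N ->
  (forall i j k l, Npos i j -> Npos k l ->
     D i j `<=` P i j -> D k l `<=` P k l ->
     forall a z, D i j a -> D k l z -> P (i + k)%N (j + l)%N (comm a z)) ->
  forall i j, Npos i j -> D i j `<=` P i j.
Proof.
move=> sP AP BP IP.
have IA k l : Npos k l -> D k l `<=` P k l -> set_comm A (D k l) `<=` P k.+1 l.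
  by move=> kl Pkl; apply: set_comm_min; [exact: sP|exact: (IP 1%N 0%N)].
have IB k l : Npos k l -> D k l `<=` P k l -> set_comm B (D k l) `<=` P k l.+1.
  by move=> kl Pkl; apply: set_comm_min; [exact: sP|exact: (IP 0%N 1%N)].
elim=> [|i IHi]; elim=> [//|j IHj] _.
- by case: j IHj => [//|j] IHj; apply: (IB 0%N j.+1) => //; exact: IHj.
- by case: i IHi => [//|i] IHi; apply: (IA i.+1 0%N) => //; exact: IHi.
- apply: set_prod_min; first exact: sP.
    by apply: IA => //; exact: IHi.
  by apply: (IB i.+1 j) => //; exact: IHj.
Qed.

(** Induction on the first entry; when it is itself a commutator, the three subgroups lemma reduces
    to its two constituents. In degree [(0, 0)] the first entry is arbitrary, and normality of
    [D k l] suffices. *)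
Lemma comm_double_lcs i j k l a z :
  D i j a -> D k l z -> D (i + k) (j + l) (comm a z).
Proof.
have [[-> ->]|/eqP ij] := eqVneq (i, j) (0, 0)%N; last first.
  (* The degree of the second entry stays quantified, since the induction hypotheses are applied to
     second entries that are commutators. *)
  pose P i j : set G :=
    [set a | forall k l z, D k l z -> D (i + k) (j + l) (comm a z)].
  move=> Da Dz; suff /(_ i j ij a Da) PD : forall i j, Npos i j -> D i j `<=` P i j.
    exact: PD.
  apply: double_lcs_ind => {i j ij k l a z Da Dz}.
  - move=> i j _; split=> /=.
    + by move=> k l z _; rewrite (_ : comm 1 z = 1); [exact: (subgroup1 (Ds _ _))|by group_eq].
    + move=> a b Pa Pb k l z Dz; rewrite commMl.
      by apply: subgroupM => //; [exact/DJ/Pb|exact: Pa].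
    + move=> a Pa k l z Dz; rewrite commVl -comm_inv; apply: DJ.
      by apply: subgroupV => //; exact: Pa.
  - by move=> a Aa k l z; exact: comm_double_lcsl.
  - by move=> b Bb k l z; exact: comm_double_lcsr.
  - move=> i j k l ij kl Pij Pkl a b Da Db p q z Dz.
    apply: (three_subgroups (double_lcs_normal i j) (double_lcs_normal k l)
      (double_lcs_normal p q) (double_lcs_normal _ _)) Da Db Dz.
    + move=> {}b {}z {}a Db Dz Da; rewrite -comm_inv -!addnA.
      by apply: subgroupV => //; apply: Pij => //; exact: Pkl.
    + move=> {}z {}a {}b Dz Da Db.
      have -> : (i + k + p = k + (i + p))%N by lia.
      have -> : (j + l + q = l + (j + q))%N by lia.
      rewrite -comm_inv; apply: subgroupV => //; apply: Pkl => //.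
      by rewrite -comm_inv; apply: subgroupV => //; exact: Pij.
move=> _ Dz.
by rewrite /comm; apply: subgroupM => //; [exact: DJ|exact: subgroupV].
Qed.

Lemma double_lcs_le i j k l : (k <= i)%N -> (l <= j)%N -> D i j `<=` D k l.
Proof.
have [ij|/eqP ij] := eqVneq (i, j) (0, 0)%N.
  by case: ij => -> ->; rewrite !leqn0 => /eqP-> /eqP->.
move=> ki lj z Dz; move: k l ki lj.
pose P i j : set G :=
  [set z | forall k l, (k <= i)%N -> (l <= j)%N -> D k l z].
suff /(_ i j ij z Dz) : forall i j, Npos i j -> D i j `<=` P i j by [].
apply: double_lcs_ind => {i j ij z Dz}.
- move=> i j _; split=> /=.
  + by move=> k l _ _; exact: subgroup1.
  + by move=> a b Pa Pb k l ki lj; apply: subgroupM => //; [exact: Pa|exact: Pb].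
  + by move=> a Pa k l ki lj; apply: subgroupV => //; exact: Pa.
- by move=> a Aa [|[|]] // [].
- by move=> b Bb [] // [|[|]].
- move=> i j k l ij kl Pij Pkl a z Da Dz p q pik qjl.
  (* The target degree is split as [p = minn p i + (p - minn p i)], whose parts are at most [i] and
     [k]; likewise for [q]. *)
  rewrite -(subnKC (geq_minl p i)) -(subnKC (geq_minl q j)).
  by apply: comm_double_lcs; [apply: Pij Da _ _ _ _|apply: Pkl Dz _ _ _ _]; lia.
Qed.

Lemma double_lcs_gt_normal m n : is_normal (Dgt m n).
Proof. by apply: set_prod_normal; exact: double_lcs_normal. Qed.

Lemma double_lcs_sub_gt m n i j : (m <= i)%N -> (n <= j)%N -> (m + n < i + j)%N ->
  D i j `<=` Dgt m n.
Proof.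
move=> mi nj mnij; have [mi'|im] := ltnP m i.
  by apply: subset_trans (set_prodl _); [exact: double_lcs_le|exact: subgroup1].
apply: subset_trans (set_prodr _); last by exact: subgroup1.
by apply: double_lcs_le => //; lia.
Qed.

Lemma double_lcs_gt_sub m n : Dgt m n `<=` D m n.
Proof. by apply: set_prod_min => //; exact: double_lcs_le. Qed.

Hypothesis AB : set_prod A B = setT.

(** Since [G = A B], the action of [G] by conjugation is trivial on the graded
    quotients. *)
Lemma comm_double_lcs_gt m n g z : D m n z -> Dgt m n (comm g z).
Proof.
move=> Dz; have [[_ gtM _] gtJ] := double_lcs_gt_normal m n.
have : set_prod A B g by rewrite AB.
case=> a Aa [b Bb <-]; rewrite commMl; apply: gtM; first apply: gtJ.
  by apply: set_prodr; [exact: subgroup1|exact: comm_double_lcsr].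
by apply: set_prodl; [exact: subgroup1|exact: comm_double_lcsl].
Qed.

End DoubleLowerCentralSeries.

(** * Subgroups and free bases *)

Definition subgroup_type (G : groupType) (N : set G) (sN : is_subgroup N) : Type :=
  {a : G | `[< N a >]}.

Section FreeBasis.
Context (G : groupType) (N : set G) (sN : is_subgroup N).

HB.instance Definition _ := [isSub of subgroup_type sN for sval].
HB.instance Definition _ := [Choice of subgroup_type sN by <:].

Fact subgroup_type_closed : group_closed (fun a : G => `[< N a >]).
Proof.
have [N1 NM NV] := sN; split; first exact/asboolP.
by move=> a b /asboolP Na /asboolP Nb; apply/asboolP/NM => //; exact: NV.
Qed.

HB.instance Definition _ :=
  SubChoice_isSubGroup.Build G _ (subgroup_type sN) subgroup_type_closed.

(** A free basis generates: the universal property, applied to [N] made into a group, gives a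
    morphism to [N] fixing the basis. Followed by the inclusion it is an endomorphism fixing the
    basis, hence the identity by uniqueness. *)
Lemma free_basis_ind (J : Type) (e : J -> G) :
  free_basis e -> (forall j, N (e j)) -> forall a, N a.
Proof.
move=> fe Ne a.
have Ne' j : `[< N (e j) >] by apply/asboolP.
have [f [[fM fe'] _]] := fe (subgroup_type sN) (fun j => exist _ (e j) (Ne' j)).
have [i [_ i_uniq]] := fe G e.
have valf : sval \o f = id.
  rewrite -(i_uniq id) //; apply/esym/i_uniq; split=> [b c|j] /=.
    by rewrite fM; exact: (monoid.valM (f b) (f c)).
  by rewrite fe'.
have /asboolP : `[< N (sval (f a)) >] := svalP (f a).
by rewrite [sval _](congr1 (@^~ a) valf).
Qed.

End FreeBasis.

(** * Lie rings and derivations of free Lie rings *)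

Section AdditiveMaps.
Context (U V : zmodType) (f : U -> V) (fD : forall u v, f (u + v) = f u + f v).

Lemma addD0 : f 0 = 0.
Proof. by apply: (addrI (f 0)); rewrite -fD !addr0. Qed.

Lemma addDN u : f (- u) = - f u.
Proof. by apply/eqP; rewrite -addr_eq0 -fD addNr addD0. Qed.

End AdditiveMaps.

Section LieRingTheory.
Context (L : lieRingType).
Implicit Types u v w : L.

Lemma lieNl u v : lie (- u) v = - lie u v.
Proof. exact: (addDN (fun u w => lieDl u w v)). Qed.

Lemma lieNr u v : lie u (- v) = - lie u v.
Proof. exact: (addDN (lieDr u)). Qed.

Lemma lieC u v : lie u v = - lie v u.
Proof.
apply/eqP; rewrite -addr_eq0; apply/eqP.
by have := lie_alt (u + v); rewrite lieDl !lieDr !lie_alt add0r addr0.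
Qed.

End LieRingTheory.

(** [L + L eps] with [eps ^ 2 = 0]: a map [u |-> u + d u eps] from [L] is a
    morphism of Lie rings if and only if [d] is a derivation. *)
Definition lie_dual (L : lieRingType) : Type := (L * L)%type.

Section LieDual.
Context (L : lieRingType).
Implicit Types u v w : lie_dual L.

HB.instance Definition _ := GRing.Zmodule.on (lie_dual L).

Definition lie_dual_lie u v : lie_dual L :=
  (lie u.1 v.1, lie u.1 v.2 + lie u.2 v.1).

Fact lie_dual_lieDl u v w :
  lie_dual_lie (u + v) w = lie_dual_lie u w + lie_dual_lie v w.
Proof. by congr (_, _); rewrite /= !lieDl // addrACA. Qed.

Fact lie_dual_lieDr u v w :
  lie_dual_lie u (v + w) = lie_dual_lie u v + lie_dual_lie u w.
Proof. by congr (_, _); rewrite /= !lieDr // addrACA. Qed.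

Fact lie_dual_alt u : lie_dual_lie u u = 0.
Proof. by congr (_, _); rewrite /= ?lie_alt // lieC addNr. Qed.

Fact lie_dual_jacobi u v w :
  lie_dual_lie u (lie_dual_lie v w) + lie_dual_lie v (lie_dual_lie w u)
    + lie_dual_lie w (lie_dual_lie u v) = 0.
Proof.
congr (_, _); rewrite /= ?lie_jacobi // !lieDr.
(* The coefficient of [eps] is the sum of the three Jacobi identities in which exactly one argument
   is replaced by its [eps] component. *)
have := congr2 +%R (congr2 +%R (lie_jacobi u.1 v.1 w.2) (lie_jacobi u.1 v.2 w.1))
  (lie_jacobi u.2 v.1 w.1).
rewrite !addr0 => <-.
by rewrite !addrA [LHS](ACl (1*5*9*2*6*7*3*4*8)).
Qed.

HB.instance Definition _ := isLieRing.Build (lie_dual L)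
  lie_dual_lieDl lie_dual_lieDr lie_dual_alt lie_dual_jacobi.

End LieDual.

Section FreeLieTheory.
Context (H : zmodType).

Lemma free_lie_ind (P : free_lie H -> Prop) :
  (forall c, P (fl_gen c)) -> P 0 -> (forall u v, P u -> P v -> P (u + v)) ->
  (forall u, P u -> P (- u)) -> (forall u v, P u -> P v -> P (lie u v)) ->
  forall u, P u.
Proof.
move=> Pg P0 PD PN PL u; rewrite -[u]fl_repr.
elim: (repr u) => [c||s Ps t Pt|t Pt|s Ps t Pt] //; first exact: Pg.
- by rewrite -fl_addE; exact: PD.
- by rewrite -fl_oppE; exact: PN.
- by rewrite -fl_lieE; exact: PL.
Qed.

(** The universal property extends [c |-> c + f c eps] to a morphism into the dual numbers. Its
    first component is the identity, so its second component is a derivation. *)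
Lemma free_lie_derivation (f : {additive H -> free_lie H}) :
  exists d : free_lie H -> free_lie H,
    [/\ forall u v, d (u + v) = d u + d v,
        forall u v, d (lie u v) = lie (d u) v + lie u (d v) &
        forall c, d (fl_gen c) = f c].
Proof.
pose f' (c : H) : lie_dual (free_lie H) := (fl_gen c, f c).
have f'D b c : f' (b + c) = f' b + f' c by rewrite /f' fl_genD raddfD.
pose F' : {additive H -> lie_dual (free_lie H)} :=
  HB.pack f' (GRing.isNmodMorphism.Build _ _ f' (addD0 f'D, f'D)).
have [F [[[FD FL] FG] _]] := free_lie_universal F'.
have F1 u : (F u).1 = u.
  elim/free_lie_ind: u => [c||u v Hu Hv|u Hu|u v Hu Hv].
  - by rewrite FG.
  - by rewrite addD0.
  - by rewrite FD /= Hu Hv.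
  - by rewrite addDN //= Hu.
  - by rewrite FL /= Hu Hv.
exists (fun u => (F u).2); split=> [u v|u v|c].
- by rewrite FD.
- by rewrite FL /= !F1 addrC.
- by rewrite FG.
Qed.

Lemma free_lie_derivation_ext (d d' : free_lie H -> free_lie H) :
  (forall u v, d (u + v) = d u + d v) ->
  (forall u v, d (lie u v) = lie (d u) v + lie u (d v)) ->
  (forall u v, d' (u + v) = d' u + d' v) ->
  (forall u v, d' (lie u v) = lie (d' u) v + lie u (d' v)) ->
  (forall c, d (fl_gen c) = d' (fl_gen c)) -> d = d'.
Proof.
move=> dD dL d'D d'L dg; apply/funext.
elim/free_lie_ind => [//||u v|u|u v].
- by rewrite !addD0.
- by rewrite dD d'D => -> ->.
- by rewrite !addDN // => ->.
- by rewrite dL d'L => -> ->.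
Qed.

End FreeLieTheory.

(** * Group morphisms and the displacement of an endomorphism *)

Section Morphism.
Context (G G' : groupType) (f : G -> G').
Context (fM : forall a b, (f (a * b) = f a * f b)%g).
Local Open Scope group_scope.

Lemma morph1 : f 1 = 1.
Proof. by apply: (mulgI (f 1)); rewrite -fM !mulg1. Qed.

Lemma morphV a : f a^-1 = (f a)^-1.
Proof. by apply: (mulgI (f a)); rewrite -fM !mulgV morph1. Qed.

Lemma morph_comm a b : f (comm a b) = comm (f a) (f b).
Proof. by rewrite /comm !fM !morphV. Qed.

Lemma kernel_normal : is_normal [set a | f a = 1].
Proof.
split; [split|] => [|a b|a|a b] /=; first exact: morph1.
- by rewrite fM => -> ->; rewrite mulg1.
- by rewrite morphV => ->; rewrite invg1.
- by rewrite !fM morphV => ->; rewrite mulg1 mulgV.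
Qed.

End Morphism.

Section Endomorphism.
Context (G : groupType) (A B : set G) (nA : is_normal A) (nB : is_normal B).
Context (phi : G -> G) (phiM : forall a b, (phi (a * b) = phi a * phi b)%g).
Context (m n : nat).
Local Open Scope group_scope.

Local Notation D := (double_lcs A B).
Local Notation Dgt := (double_lcs_gt A B).

(** The [[phi, a]] of the paper. *)
Definition displ a := phi a * a^-1.

Lemma displM a b : displ (a * b) = displ a * (a * displ b * a^-1).
Proof. by rewrite /displ phiM; group_eq. Qed.

Lemma displV a : displ a^-1 = a^-1 * (displ a)^-1 * a^-1^-1.
Proof. by rewrite /displ (morphV phiM); group_eq. Qed.

(** An exact form of the Leibniz rule, from [phi a = displ a * a]: the outer factors are conjugates
    of [comm a (displ b)] and [comm (displ a) b], and the inner ones are error terms of higher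
    degree. *)
Lemma displ_comm a b : let c := comm a b in
  displ c = displ a * comm a (displ b) * (displ a)^-1
    * comm (displ a * displ b) c
    * (c * comm (displ a) (displ b) * c^-1)
    * (c * (displ b * comm (displ a) b * (displ b)^-1) * c^-1).
Proof.
rewrite /= {1}/displ (morph_comm phiM).
have -> : phi a = displ a * a by rewrite /displ mulgVK.
have -> : phi b = displ b * b by rewrite /displ mulgVK.
by group_eq.
Qed.

Hypothesis displA : forall a, A a -> D m.+1 n (displ a).
Hypothesis displB : forall b, B b -> D m n.+1 (displ b).

Let nD i j := double_lcs_normal nA nB i j.
Let nDgt i j := double_lcs_gt_normal nA nB i j.

(** Induction on commutators: [displM] and [displV] make the condition define a subgroup, and each
    factor in [displ_comm] has at least the required degree. *)
Lemma displ_double_lcs i j : Npos i j ->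
  forall z, D i j z -> D (m + i) (n + j) (displ z).
Proof.
pose P i j : set G := [set z | D (m + i) (n + j) (displ z)].
suff PD : forall i j, Npos i j -> D i j `<=` P i j by exact: PD.
apply: double_lcs_ind => {i j}.
- move=> i j _; have [sD DJ] := nD (m + i) (n + j); split; rewrite /P /=.
  + by rewrite /displ (morph1 phiM) mulgV; exact: subgroup1.
  + by move=> a b Pa Pb; rewrite displM; apply: subgroupM => //; exact: DJ.
  + by move=> a Pa; rewrite displV; apply: DJ; exact: subgroupV.
- by move=> a /displA; rewrite /P /= addn0 addn1.
- by move=> a /displB; rewrite /P /= addn0 addn1.
- move=> i j k l _ _ Pij Pkl a z Da Dz; rewrite /P /= displ_comm.
  set c := comm a z.
  have [sD DJ] := nD (m + (i + k)) (n + (j + l)).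
  have Dc : D (i + k) (j + l) c by exact: comm_double_lcs.
  have {}Pa := Pij _ Da; have {}Pz := Pkl _ Dz.
  apply: subgroupM => //; last first.
    apply/DJ/DJ; rewrite !addnA; exact: comm_double_lcs.
  apply: subgroupM => //; last first.
    apply/DJ; apply: double_lcs_le (comm_double_lcs nA nB Pa Pz) => //; lia.
  apply: subgroupM => //.
    by apply: DJ; rewrite addnCA [(n + _)%N]addnCA; exact: comm_double_lcs.
  rewrite commMl; apply: subgroupM => //; first apply: DJ.
    apply: double_lcs_le (comm_double_lcs nA nB Pz Dc) => //; lia.
  apply: double_lcs_le (comm_double_lcs nA nB Pa Dc) => //; lia.
Qed.

Lemma displ_double_lcs_gt i j z : Dgt i j z -> Dgt (m + i) (n + j) (displ z).
Proof.
have [sD DJ] := nDgt (m + i) (n + j).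
move=> [a Da [b Db <-]]; rewrite displM; apply: subgroupM => //; last apply: DJ.
  apply: set_prodl; first exact: (subgroup1 (nD _ _).1).
  by rewrite -addnS; apply: displ_double_lcs.
apply: set_prodr; first exact: (subgroup1 (nD _ _).1).
by rewrite -addnS; apply: displ_double_lcs => //; case: (i).
Qed.

End Endomorphism.

(** * Abelianization of a free group *)

Section Abelianization.
Context (G : groupType) (J : Type) (e : J -> G) (fe : free_basis e).

Lemma abel_classM (a b : G) :
  abel_class (a * b)%g = abel_class a + abel_class b.
Proof. by rewrite -[LHS]abel_addE. Qed.

Lemma abel_class1 : abel_class 1%g = 0 :> abel G.
Proof. by []. Qed.

Lemma abel_classV (a : G) : abel_class a^-1%g = - abel_class a.
Proof. by apply/eqP; rewrite -addr_eq0 -abel_classM mulVg. Qed.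

(** The universal property is applied to [V] written multiplicatively; since [V] is abelian, the
    resulting map kills commutators and descends to [abel G]. *)
Lemma free_basis_additive (V : zmodType) (v : J -> V) :
  exists f : {additive abel G -> V}, forall j, f (abel_class (e j)) = v j.
Proof.
have [f [[fM fe'] _]] := fe (G := Algebra.to_multiplicative V) v.
have fD a b : f (a * b)%g = (f a : V) + f b by exact: fM.
have fcomm : @derived G `<=` [set a | f a = 1%g].
  have [sN NJ] := kernel_normal fM.
  apply: set_comm_min => // a b _ _.
  have fC : (f a * f b = f b * f a)%g by exact: (@addrC V).
  by rewrite /= (morph_comm fM) /comm fC mulgK mulgV.
have fE a b : abel_class a = abel_class b -> f a = f b.
  move=> /abel_classP /fcomm; rewrite /= fM (morphV fM) => /(canRL (mulgVK _)).
  by rewrite mul1g.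
pose f' (c : abel G) : V := f (repr c).
have f'E a : f' (abel_class a) = f a by apply: fE; exact: abel_repr.
have f'D c c' : f' (c + c') = f' c + f' c'.
  by rewrite -[c]abel_repr -[c']abel_repr -abel_classM !f'E fD.
pose F : {additive abel G -> V} :=
  HB.pack f' (GRing.isNmodMorphism.Build _ _ f' (addD0 f'D, f'D)).
by exists F => j; rewrite /= f'E fe'.
Qed.

Lemma free_basis_additive_ext (V : zmodType) (f f' : abel G -> V) :
  (forall c c', f (c + c') = f c + f c') ->
  (forall c c', f' (c + c') = f' c + f' c') ->
  (forall j, f (abel_class (e j)) = f' (abel_class (e j))) -> f =1 f'.
Proof.
move=> fD f'D ff' c; rewrite -[c]abel_repr; move: (repr c) => {c} a.
pose N : set G := [set a | f (abel_class a) = f' (abel_class a)].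
have sN : is_subgroup N.
  split=> [|b b' Hb Hb'|b Hb]; rewrite /N /=.
  - by rewrite abel_class1 !addD0.
  - by rewrite abel_classM fD f'D Hb Hb'.
  - by rewrite abel_classV !addDN // Hb.
exact: (free_basis_ind sN fe).
Qed.

End Abelianization.

(** * The kernels in the surface group and their graded Lie ring *)

Section DoubleJohnson.
Context (R : realType) (g : nat) (S : pointed_splitting R g).
Context (x y : 'I_g -> K S) (xy : standard_basis x y).
Context (theta : nat -> nat -> K S -> LieAB S).
Context (id_theta : lie_identification x y theta).
Implicit Types a b c z w : K S.

Lemma inVM (a b : K S) : inV (a * b)%g = (inV a * inV b)%g.
Proof. exact: pi1_mapM. Qed.

Lemma inV'M (a b : K S) : inV' (a * b)%g = (inV' a * inV' b)%g.
Proof. exact: pi1_mapM. Qed.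

Lemma Xbar_normal : is_normal (@Xbar R g S).
Proof. exact: kernel_normal inVM. Qed.

Lemma Ybar_normal : is_normal (@Ybar R g S).
Proof. exact: kernel_normal inV'M. Qed.

Let nX := Xbar_normal.
Let nY := Ybar_normal.

Lemma mcg_actM (h : mapping_class S) (a b : K S) :
  mcg_act h (a * b)%g = (mcg_act h a * mcg_act h b)%g.
Proof. exact: pi1_mapM. Qed.

Lemma Xbar_x i : Xbar (x i).
Proof.
have [_ -> _ _] := xy; apply: sub_gen; exists 1%g => //.
by exists (x i); [exists i|rewrite invg1 mulg1 mul1g].
Qed.

Lemma Ybar_y i : Ybar (y i).
Proof.
have [_ _ -> _] := xy; apply: sub_gen; exists 1%g => //.
by exists (y i); [exists i|rewrite invg1 mulg1 mul1g].
Qed.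

(** The product is a subgroup containing the free basis. This is what makes conjugation by any
    element of [K S] trivial on the graded quotients. *)
Lemma set_prod_XYbar : set_prod (@Xbar R g S) (@Ybar R g S) = setT.
Proof.
apply/seteqP; split=> // a _; have [fe _ _ _] := xy.
apply: (free_basis_ind _ fe); first exact: (set_prod_normal nX nY).1.
case=> i; first by apply: set_prodl; [exact: (subgroup1 nY.1)|exact: Xbar_x].
by apply: set_prodr; [exact: (subgroup1 nX.1)|exact: Ybar_y].
Qed.

Let nK i j : is_normal (@Kmn R g S i j) := double_lcs_normal nX nY i j.
Let nKgt i j : is_normal (@Kgt R g S i j) := double_lcs_gt_normal nX nY i j.

Lemma theta_gt i j z : Npos i j -> Kgt i j z -> theta i j z = 0.
Proof.
by move=> ij gz; apply/(theta_ker id_theta ij) => //; exact: double_lcs_gt_sub gz.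
Qed.

Lemma theta1 i j : Npos i j -> theta i j 1%g = 0.
Proof. by move=> ij; apply: theta_gt => //; exact: (subgroup1 (nKgt i j).1). Qed.

Lemma thetaV i j z : Npos i j -> Kmn i j z -> theta i j z^-1%g = - theta i j z.
Proof.
move=> ij Kz; apply/eqP; rewrite -addr_eq0 -(thetaM id_theta ij) //.
  by rewrite mulVg theta1.
exact: subgroupV (nK i j).1 Kz.
Qed.

(** Conjugation multiplies [z] by [comm a z], which lies in [Kgt i j]. *)
Lemma thetaJ i j a z : Npos i j -> Kmn i j z ->
  theta i j (a * z * a^-1)%g = theta i j z.
Proof.
move=> ij Kz; have gaz := comm_double_lcs_gt nX nY set_prod_XYbar a Kz.
have -> : (a * z * a^-1 = comm a z * z)%g by rewrite /comm mulgVK.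
rewrite (thetaM id_theta ij) //; last exact: double_lcs_gt_sub gaz.
by rewrite theta_gt // add0r.
Qed.

(** * The derivation induced by a mapping class *)

Context (m n : nat) (mn : Npos m n) (h : mapping_class S).
Context (hmn : double_johnson m n h).

Let mn_Npos i j : Npos (m + i) (n + j).
Proof. by move: mn; rewrite /Npos => + [??]; apply; congr (_, _); lia. Qed.

Lemma mcg_comm_Xbar a : Xbar a -> Kmn m.+1 n (mcg_comm h a).
Proof. by have [_ _ hX _] := hmn => Xa; apply: hX; exists a. Qed.

Lemma mcg_comm_Ybar a : Ybar a -> Kmn m n.+1 (mcg_comm h a).
Proof. by have [_ _ _ hY] := hmn => Ya; apply: hY; exists a. Qed.

Lemma mcg_comm_Kmn i j z : Npos i j -> Kmn i j z ->
  Kmn (m + i) (n + j) (mcg_comm h z).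
Proof.
move=> ij Kz; apply: (displ_double_lcs nX nY (mcg_actM h)) => // a.
  exact: mcg_comm_Xbar.
exact: mcg_comm_Ybar.
Qed.

Lemma mcg_comm_Kgt i j z : Kgt i j z -> Kgt (m + i) (n + j) (mcg_comm h z).
Proof.
move=> Kz; apply: (displ_double_lcs_gt nX nY (mcg_actM h)) => // a.
  exact: mcg_comm_Xbar.
exact: mcg_comm_Ybar.
Qed.

Local Notation tau i j z := (theta (m + i)%N (n + j)%N (mcg_comm h z)).

(** The displacement is a crossed homomorphism, and [theta] does not see the conjugation that twists
    it. *)
Lemma tauM i j z w : Npos i j -> Kmn i j z -> Kmn i j w ->
  tau i j (z * w)%g = tau i j z + tau i j w.
Proof.
move=> ij Kz Kw; have hz := mcg_comm_Kmn ij Kz; have hw := mcg_comm_Kmn ij Kw.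
rewrite [mcg_comm h _](displM (mcg_actM h)) (thetaM id_theta (@mn_Npos i j)) //.
  by rewrite thetaJ.
exact: (nK _ _).2.
Qed.

Lemma tau1 i j : tau i j 1%g = 0.
Proof. by rewrite /mcg_comm (morph1 (mcg_actM h)) mulgV theta1. Qed.

Lemma tauV i j z : Npos i j -> Kmn i j z -> tau i j z^-1%g = - tau i j z.
Proof.
move=> ij Kz; apply/eqP; rewrite -addr_eq0 -tauM //.
  by rewrite mulVg tau1.
exact: subgroupV (nK i j).1 Kz.
Qed.

Lemma tau_gt i j z : Kgt i j z -> tau i j z = 0.
Proof. by move=> /mcg_comm_Kgt; exact: theta_gt. Qed.

Lemma tauJ i j a z : Npos i j -> Kmn i j z -> tau i j (a * z * a^-1)%g = tau i j z.
Proof.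
move=> ij Kz; have gaz := comm_double_lcs_gt nX nY set_prod_XYbar a Kz.
have -> : (a * z * a^-1 = comm a z * z)%g by rewrite /comm mulgVK.
rewrite tauM //; last exact: double_lcs_gt_sub gaz.
by rewrite tau_gt // add0r.
Qed.

(** The Leibniz rule: of the four factors in [displ_comm], the inner two lie in [Kgt] and the outer
    two give the two brackets, up to conjugation. *)
Lemma tau_comm i j k l a z : Npos i j -> Npos k l -> Kmn i j a -> Kmn k l z ->
  tau (i + k)%N (j + l)%N (comm a z)
  = lie (tau i j a) (theta k l z) + lie (theta i j a) (tau k l z).
Proof.
move=> ij kl Ka Kz; have ha := mcg_comm_Kmn ij Ka; have hz := mcg_comm_Kmn kl Kz.
have cK i' j' k' l' b w : Kmn i' j' b -> Kmn k' l' w ->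
    Kmn (i' + k') (j' + l') (comm b w).
  exact: comm_double_lcs.
have gtK i' j' b : (m + (i + k) <= i')%N -> (n + (j + l) <= j')%N ->
    (m + (i + k) + (n + (j + l)) < i' + j')%N -> Kmn i' j' b ->
    Kgt (m + (i + k)) (n + (j + l)) b.
  by move=> Hi Hj Hij; exact: double_lcs_sub_gt.
have [sK KJ] := nK (m + (i + k)) (n + (j + l)).
have [sKgt KgtJ] := nKgt (m + (i + k)) (n + (j + l)).
have NMN : Npos (m + (i + k)) (n + (j + l)) by exact: mn_Npos.
have Kc := cK _ _ _ _ _ _ Ka Kz.
rewrite [mcg_comm h _](displ_comm (mcg_actM h)).
set c := comm a z in Kc *; set a' := displ _ a; set z' := displ _ z.
(* The commutators of [z'] with [c], of [a'] with [c] and of [a'] with [z'] exceed the expected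
   degree by [(k, l)], [(i, j)] and [(m, n)]; positivity of these totals puts them in [Kgt]. *)
have ltmn : (0 < m + n)%N by move: mn; rewrite /Npos; case: (m) (n) => [|?] [|?].
have ltij : (0 < i + j)%N by move: ij; rewrite /Npos; case: (i) (j) => [|?] [|?].
have ltkl : (0 < k + l)%N by move: kl; rewrite /Npos; case: (k) (l) => [|?] [|?].
have Kaz' : Kmn (m + (i + k)) (n + (j + l)) (comm a z').
  by rewrite addnCA [(n + _)%N]addnCA; exact: cK.
have Ka'z : Kmn (m + (i + k)) (n + (j + l)) (comm a' z).
  by rewrite !addnA; exact: cK.
have g1 : Kgt (m + (i + k)) (n + (j + l)) (comm (a' * z')%g c).
  rewrite commMl; apply: subgroupM => //; first apply: KgtJ.
    by apply: gtK (cK _ _ _ _ _ _ hz Kc); lia.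
  by apply: gtK (cK _ _ _ _ _ _ ha Kc); lia.
have g2 : Kgt (m + (i + k)) (n + (j + l)) (c * comm a' z' * c^-1)%g.
  by apply/KgtJ; apply: gtK (cK _ _ _ _ _ _ ha hz); lia.
have gK := @double_lcs_gt_sub _ _ _ nX nY (m + (i + k)) (n + (j + l)).
have K1 := gK _ g1; have K2 := gK _ g2.
have K0 : Kmn (m + (i + k)) (n + (j + l)) (a' * comm a z' * a'^-1)%g by exact: KJ.
have K3 : Kmn (m + (i + k)) (n + (j + l)) (c * (z' * comm a' z * z'^-1) * c^-1)%g.
  by apply/KJ/KJ.
have K01 := subgroupM sK K0 K1; have K012 := subgroupM sK K01 K2.
rewrite (thetaM id_theta NMN K012 K3) (thetaM id_theta NMN K01 K2).
rewrite (thetaM id_theta NMN K0 K1) (theta_gt NMN g1) (theta_gt NMN g2) !addr0.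
rewrite !thetaJ //; last by apply: KJ.
rewrite addrC; congr (_ + _).
  by rewrite !addnA (theta_lie id_theta).
by rewrite addnCA [(n + _)%N]addnCA (theta_lie id_theta).
Qed.

(** The elements on which [d] agrees with the action of [h] form subgroups stable under conjugation.
    They contain the [x i] and [y i], hence the normal closures [Xbar] and [Ybar], hence the whole
    series by induction on commutators. *)
Lemma derivation_tau (d : LieAB S -> LieAB S) :
  (forall u v, d (u + v) = d u + d v) ->
  (forall u v, d (lie u v) = lie (d u) v + lie u (d v)) ->
  (forall i, d (fl_gen (gens x i)) = theta m.+1 n (mcg_comm h (x i))) ->
  (forall i, d (fl_gen (gens y i)) = theta m n.+1 (mcg_comm h (y i))) ->
  is_tau theta m n h d.
Proof.
move=> dD dL dx dy.
pose P i j : set (K S) := [set z | Kmn i j z /\ d (theta i j z) = tau i j z].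
have sP i j : Npos i j -> is_subgroup (P i j).
  move=> ij; have [sK KJ] := nK i j; split.
  - by split; [exact: subgroup1|rewrite theta1 // addD0 // tau1].
  - move=> a b [Ka Pa] [Kb Pb]; split; first exact: subgroupM.
    by rewrite (thetaM id_theta) // dD Pa Pb tauM.
  - move=> a [Ka Pa]; split; first exact: subgroupV.
    by rewrite thetaV // addDN // Pa tauV.
have PJ i j a z : Npos i j -> P i j z -> P i j (a * z * a^-1)%g.
  move=> ij [Kz Pz]; split; first exact: (nK i j).2.
  by rewrite thetaJ // Pz tauJ.
have P10 : @Xbar R g S `<=` P 1%N 0%N.
  have [_ {1}-> _ _] := xy.
  apply: gen_min => [|_ [a _ [_ [i _ <-] <-]]]; first exact: sP.
  apply: PJ => //; split; first exact: Xbar_x.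
  by rewrite (theta_x id_theta) dx addn1 addn0.
have P01 : @Ybar R g S `<=` P 0%N 1%N.
  have [_ _ {1}-> _] := xy.
  apply: gen_min => [|_ [a _ [_ [i _ <-] <-]]]; first exact: sP.
  apply: PJ => //; split; first exact: Ybar_y.
  by rewrite (theta_y id_theta) dy addn1 addn0.
have PK : forall i j, Npos i j -> Kmn i j `<=` P i j.
  apply: double_lcs_ind => // i j k l ij kl Pij Pkl a z Ka Kz.
  split; first exact: comm_double_lcs.
  have [_ Pa] := Pij _ Ka; have [_ Pz] := Pkl _ Kz.
  by rewrite (theta_lie id_theta) // dL Pa Pz tau_comm.
split; last first.
  by move=> i j ij z Kz; split; [exact: mcg_comm_Kmn|have [] := PK i j ij z Kz].
(* That [d] has degree [(m, n)] follows because [theta i j] maps [Kmn i j] onto [Lie i j]. *)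
split=> // i j ij _ [u + <-]; rewrite -(theta_Lie id_theta ij) => -[z Kz <-].
have [_ ->] := PK i j ij z Kz.
by rewrite -(theta_Lie id_theta (@mn_Npos i j)); exists (mcg_comm h z) => //;
  exact: mcg_comm_Kmn.
Qed.

Lemma Kmn_x i : Kmn 1 0 (x i). Proof. exact: Xbar_x. Qed.

Lemma Kmn_y i : Kmn 0 1 (y i). Proof. exact: Ybar_y. Qed.

Lemma is_tau_gens (d : LieAB S -> LieAB S) : is_tau theta m n h d ->
  (forall i, d (fl_gen (gens x i)) = theta m.+1 n (mcg_comm h (x i))) /\
  (forall i, d (fl_gen (gens y i)) = theta m n.+1 (mcg_comm h (y i))).
Proof.
move=> [_ dK]; split=> i.
- have [//|_] := dK 1%N 0%N _ _ (Kmn_x i).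
  by rewrite (theta_x id_theta) addn1 addn0.
- have [//|_] := dK 0%N 1%N _ _ (Kmn_y i).
  by rewrite (theta_y id_theta) addn1 addn0.
Qed.

(** The classes of the free basis freely generate [H1 S], so the prescribed values extend additively
    to [H1 S] and then to a derivation; both extensions are determined by these values. *)
Lemma is_tau_exists_unique : exists d, unique (is_tau theta m n h) d.
Proof.
have [fe _ _ _] := xy.
have [f fE] := free_basis_additive fe (fun k => match k with
  | inl i => theta m.+1 n (mcg_comm h (x i))
  | inr i => theta m n.+1 (mcg_comm h (y i)) end).
have [d [dD dL df]] := free_lie_derivation f.
have dtau : is_tau theta m n h d.
  by apply: derivation_tau => // i; rewrite df; [exact: (fE (inl i))|exact: (fE (inr i))].
exists d; split=> // d' d'tau.
have [dx dy] := is_tau_gens dtau; have [d'x d'y] := is_tau_gens d'tau.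
have [[d'D d'L _] _] := d'tau.
apply: free_lie_derivation_ext => //.
apply: (free_basis_additive_ext fe) => [c c'|c c'|[i|i]].
- by rewrite fl_genD dD.
- by rewrite fl_genD d'D.
- by rewrite dx d'x.
- by rewrite dy d'y.
Qed.

(** [h] is the identity on the boundary of [Sigma], whose loop represents the
    inverse of this product. *)
Lemma mcg_act_boundary : let z := (\big[*%g/1]_(i < g) comm (x i)^-1 (y i)^-1)%g in
  mcg_act h z = z.
Proof.
have [_ _ _ [u [[uS _] <-]]] := xy.
rewrite /= (morphV (mcg_actM h)); congr (_^-1)%g.
rewrite [LHS]pi1_mapE; apply/pi1_classP.
apply: (@homotopic_reparam _ _ _ u _ _ id id) => // [t|t|t It] /=.
- exact: cvg_id.
- exact: cvg_id.
- by apply: bdh_bdry; rewrite -uS; exists t.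
Qed.

Lemma theta_boundary : let z := (\big[*%g/1]_(i < g) comm (x i)^-1 (y i)^-1)%g in
  Kmn 1 1 z /\ theta 1 1 z = Omega x y.
Proof.
rewrite /Omega /=; have sK := (nK 1 1).1.
(* Membership is carried along with the value, as [theta] is additive only on [Kmn 1 1]. *)
apply: (big_ind2 (fun z u => Kmn 1 1 z /\ theta 1 1 z = u)) => [|a u b v|i _].
- by split; [exact: subgroup1|exact: theta1].
- move=> [Ka <-] [Kb <-]; split; first exact: subgroupM.
  exact: (thetaM id_theta).
- have Kx := Kmn_x i; have Ky := Kmn_y i.
  have KxV := subgroupV (nK 1 0).1 Kx; have KyV := subgroupV (nK 0 1).1 Ky.
  split; first exact: (comm_double_lcs nX nY KxV KyV).
  rewrite (@theta_lie _ _ _ _ _ _ id_theta 1%N 0%N 0%N 1%N) // !thetaV //.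
  by rewrite (theta_x id_theta) (theta_y id_theta) lieNl lieNr opprK.
Qed.

Lemma is_tau_Omega (d : LieAB S -> LieAB S) :
  is_tau theta m n h d -> d (Omega x y) = 0.
Proof.
move=> [_ dK]; have [Kz <-] := theta_boundary.
have [//|_ ->] := dK 1%N 1%N _ _ Kz.
by rewrite /mcg_comm mcg_act_boundary mulgV theta1.
Qed.

(** * The bracket map and the tensor of a derivation *)

Lemma Xi_tens (c : H1 S) u : Xi (tens c u) = lie (fl_gen c) u.
Proof.
by apply: tens_lift_tens; split=> *; rewrite ?fl_genD ?lieDl ?lieDr.
Qed.

Lemma XiD (s t : tensor (H1 S) (LieAB S)) : Xi (s + t) = Xi s + Xi t.
Proof.
by apply: tens_liftD; split=> *; rewrite ?fl_genD ?lieDl ?lieDr.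
Qed.

(** The sign in [derivation_tensor] turns [- [b_i, d a_i]] into [[d a_i, b_i]], the missing half of
    the Leibniz rule for [d [a_i, b_i]]. *)
Lemma Xi_derivation_tensor (d : LieAB S -> LieAB S) :
  (forall u v, d (u + v) = d u + d v) ->
  (forall u v, d (lie u v) = lie (d u) v + lie u (d v)) ->
  Xi (derivation_tensor x y d) = d (Omega x y).
Proof.
move=> dD dL.
have sumE (V W : zmodType) (f : V -> W) (F : 'I_g -> V) :
    (forall u v, f (u + v) = f u + f v) -> f (\sum_i F i) = \sum_i f (F i).
  by move=> fD; apply: big_morph; [exact: fD|exact: addD0].
rewrite /derivation_tensor XiD (addDN XiD) !(sumE _ _ _ _ XiD) (sumE _ _ _ _ dD).
rewrite -sumrB; apply: eq_bigr => i _.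
by rewrite !Xi_tens dL addrC -lieC.
Qed.

(** The class of [x i] is in [LagA] because [x i] dies in [V], and that of [y i] in [LagB] because
    [y i] dies in [V']; the second tensor factors have the right degree by the definition of
    [double_johnson]. *)
Lemma tau_tensor_part : tensor_part m n (tau_tensor x y theta m n h).
Proof.
have sumP (F : 'I_g -> tensor (H1 S) (LieAB S)) :
    (forall i, tensor_part m n (F i)) -> tensor_part m n (\sum_i F i).
  by move=> FP; apply: big_ind => //; [exact: tp0|exact: tpD].
apply: tpD; last apply: tpN; apply: sumP => i.
- apply: tpA; last first.
    rewrite -(theta_Lie id_theta); last by rewrite /Npos; case: (m).
    by exists (mcg_comm h (y i)) => //; apply/mcg_comm_Ybar/Ybar_y.
  by rewrite /LagA /= abel_mapE; [rewrite (_ : inV _ = 1%g) //; exact: Xbar_x|exact: inVM].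
- apply: tpB; last first.
    rewrite -(theta_Lie id_theta) //.
    by exists (mcg_comm h (x i)) => //; apply/mcg_comm_Xbar/Xbar_x.
  by rewrite /LagB /= abel_mapE; [rewrite (_ : inV' _ = 1%g) //; exact: Ybar_y|exact: inV'M].
Qed.

End DoubleJohnson.

Theorem proposition5p4 (R : realType) (g : nat) (S : pointed_splitting R g)
    (x y : 'I_g -> K S) (xy : standard_basis x y)
    (theta : nat -> nat -> K S -> LieAB S) (id_theta : lie_identification x y theta)
    (m n : nat) (mn : Npos m n) (h : mapping_class S)
    (hmn : double_johnson m n h) :
  Xi (tau_tensor x y theta m n h) = 0 /\
  Dmn m n (tau_tensor x y theta m n h) /\
  exists d : LieAB S -> LieAB S,
    [/\ unique (is_tau theta m n h) d,
        derivation_tensor x y d = tau_tensor x y theta m n h &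
        symplectic_derivation x y m n d].
Proof.
have [d d_tau_uniq] := is_tau_exists_unique xy id_theta mn hmn.
have [d_tau _] := d_tau_uniq; have [d_der _] := d_tau; have [dD dL _] := d_der.
have dOmega := is_tau_Omega xy id_theta mn d_tau.
have [dx dy] := is_tau_gens xy id_theta d_tau.
(* The tensor of [d] involves only its values on generators, and these are the classes of the
   displacements of the [x i] and [y i]. *)
have tauE : derivation_tensor x y d = tau_tensor x y theta m n h.
  by congr (_ - _); apply: eq_bigr => i _; rewrite ?dx ?dy.
have Xi0 : Xi (tau_tensor x y theta m n h) = 0.
  by rewrite -tauE Xi_derivation_tensor.
split=> //; split; last by exists d.
by split=> //; exact: (tau_tensor_part xy id_theta hmn).
Qed.
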